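(* Let $M$ be the $4$-manifold obtained by gluing two vertex-deleted $4$-simplices along their ideal tetrahedra according to the five gluing maps listed in the context, and let $$A=\begin{bmatrix} 0 & 0 & 1\\ 1 & 0 & 0\\ 0 & 1 & -1\end{bmatrix}.$$ Then $M$ is homeomorphic to the Cappell-Shaneson manifold $CS(A)$.
   Context: Definition of $M$. Take two disjoint $4$-simplices (pentachora) $G$ (''green'') and $R$ (''red''), each with vertices labelled $0,1,2,3,4$, and remove all their vertices. For a pentachoron $P$ and $a<b<c<d$ in $\{0,1,2,3,4\}$, let $P_{abcd}$ denote its boundary (ideal) tetrahedron spanned by the vertices $a,b,c,d$. $M$ is the quotient of $G\sqcup R$ by the following five identifications, where each arrow is the restriction (to the vertex-deleted tetrahedra) of the unique affine isomorphism sending the vertices in the listed order to the vertices in the listed order: \begin{itemize} \item $e_0:\ G_{0124}\to G_{1234}$, with $(0,1,2,4)\mapsto(1,2,3,4)$; \item $e_1:\ R_{0134}\to G_{0123}$, with $(0,1,3,4)\mapsto(0,1,2,3)$; \item $e_2:\ R_{0124}\to G_{0234}$, with $(0,1,2,4)\mapsto(0,2,3,4)$; \item $e_3:\ R_{1234}\to G_{0134}$, with $(1,2,3,4)\mapsto(0,1,3,4)$; \item $e_4:\ R_{0123}\to R_{0234}$, with $(0,1,2,3)\mapsto(0,2,3,4)$. \end{itemize} The space $M$ is a $4$-manifold. Definition of $CS(A)$. For a manifold $N$ and a diffeomorphism $f:N\to N$, let $N\rtimes_f S^1$ denote the bundle over $S^1$ with fibre $N$ and monodromy $f$, i.e. the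 quotient $(N\times\mathbb{R})/\mathbb{Z}$ where $\mathbb{Z}$ acts by $n.(p,t)=(f^n(p),n+t)$. A matrix $A\in GL_3(\mathbb{Z})$ acts linearly on $\mathbb{R}^3$ preserving $\mathbb{Z}^3$, hence acts on $(S^1)^3=\mathbb{R}^3/\mathbb{Z}^3$, fixing the image $*$ of the origin. The Cappell-Shaneson manifold associated to $A$ is $$CS(A)=\left((S^1)^3\setminus\{*\}\right)\rtimes_A S^1 .$$ *)

(* Defs.v *)
From HB Require Import structures.
From Stdlib Require Import Relation_Operators.
From mathcomp Require Import all_boot all_order all_algebra.
From mathcomp Require Import all_classical all_reals all_analysis.

Set Implicit Arguments.
Unset Strict Implicit.
Unset Printing Implicit Defensive.

Import Order.TTheory GRing.Theory Num.Theory.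
Import numFieldNormedType.Exports.

Local Open Scope classical_set_scope.
Local Open Scope ring_scope.
Local Open Scope quotient_scope.

Record homeo (X Y : topologicalType) := Homeo {
  homeo_fun :> X -> Y;
  homeo_inv : Y -> X;
  homeoK : cancel homeo_fun homeo_inv;
  homeo_invK : cancel homeo_inv homeo_fun;
  homeo_continuous : continuous homeo_fun;
  homeo_inv_continuous : continuous homeo_inv }.

Definition homeomorphic (X Y : topologicalType) : Prop := inhabited (homeo X Y).

(* The n-th power f^n of a homeomorphism, for n : int. *)
Definition homeo_iter (X : topologicalType) (f : homeo X X) (n : int) : X -> X :=
  match n with
  | Posz k => iter k f
  | Negz k => iter k.+1 (homeo_inv f)
  end.

Section generated_quotient.
Context (T : topologicalType) (r : T -> T -> Prop).

Definition gen_equiv : rel T :=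
  fun x y => `[< clos_refl_sym_trans T r x y >].

Lemma gen_equiv_refl : reflexive gen_equiv.
Proof. by move=> x; apply/asboolP; apply: rst_refl. Qed.

Lemma gen_equiv_sym : symmetric gen_equiv.
Proof.
by move=> x y; apply/idP/idP => /asboolP h; apply/asboolP; apply: rst_sym.
Qed.

Lemma gen_equiv_trans : transitive gen_equiv.
Proof.
by move=> y x z /asboolP h /asboolP k; apply/asboolP; apply: rst_trans h k.
Qed.

Canonical gen_equiv_equiv :=
  EquivRel gen_equiv gen_equiv_refl gen_equiv_sym gen_equiv_trans.

(* T modulo the smallest equivalence relation containing r. *)
Definition gen_quot := quotient_topology {eq_quot gen_equiv}.

HB.instance Definition _ := Topological.on gen_quot.
HB.instance Definition _ := Quotient.on gen_quot.

Lemma gen_quotP (x y : T) :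
  \pi_gen_quot x = \pi_gen_quot y <-> clos_refl_sym_trans T r x y.
Proof.
split; first by move/eqquotP/asboolP.
by move=> h; apply/eqquotP/asboolP.
Qed.

End generated_quotient.

(* N x| _f S^1, the quotient of N x R by n.(p, t) = (f^n p, n + t). *)
Definition mapping_torus (R : realType) (N : topologicalType) (f : homeo N N) :=
  gen_quot (fun u v : N * R =>
    exists n : int, v = (homeo_iter f n u.1, n%:~R + u.2)).

Lemma mulmx_continuous (R : realType) m n p (B : 'M[R]_(m, n)) :
  continuous (mulmx B : 'M[R]_(n, p) -> 'M[R]_(m, p)).
Proof.
move=> x U [P Px PU].
pose Q (ij : 'I_m * 'I_p) : set 'M[R]_(n, p) :=
  [set y | P ij.1 ij.2 ((B *m y) ij.1 ij.2)].
have : \forall y \near x, forall ij, Q ij y.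
  apply: (@filter_forall _ _ Q _ (nbhs_filter x)) => -[i j].
  have cB : continuous (fun y : 'M[R]_(n, p) => (B *m y) i j).
    under eq_fun do rewrite mxE.
    apply: (@continuous_big R _ +%R 0 xpredT _ 'M[R]_(n, p)
      (index_enum 'I_n) (fun k y => B i k * y k j)) => [|k _ y].
      exact: add_continuous.
    have FF := nbhs_filter y.
    apply: (@cvgM _ _ _ FF (fun=> B i k) (fun y => y k j)).
    exact: cvg_cst.
    exact: coord_continuous.
  exact: cB (Px i j).
by apply: filterS => y Py; apply: PU => i j; exact: (Py (i, j)).
Qed.

Section torus.
Context (R : realType).

Definition torus3 := gen_quot (fun x y : 'cV[R]_3 =>
  exists z : 'cV[int]_3, y = map_mx intr z + x).

Definition torus3_origin : torus3 := \pi_torus3 0.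

(* Independent of the chosen representative, see torus3_mapE. *)
Definition torus3_map (A : 'M[int]_3) (p : torus3) : torus3 :=
  \pi_torus3 (map_mx intr A *m repr p).

Lemma torus3P (x y : 'cV[R]_3) :
  \pi_torus3 x = \pi_torus3 y <-> exists z : 'cV[int]_3, y = map_mx intr z + x.
Proof.
split; last by move=> h; apply/gen_quotP/rst_step.
move/gen_quotP; elim=> {x y} [x y //|x|x y _ [z ->]|x y w _ [z ->] _ [z' ->]].
- by exists 0; rewrite map_mx0 add0r.
- by exists (- z); rewrite map_mxN addrA addNr add0r.
- by exists (z' + z); rewrite map_mxD addrA.
Qed.

Lemma torus3_mapE A (x : 'cV[R]_3) :
  torus3_map A (\pi_torus3 x) = \pi_torus3 (map_mx intr A *m x).
Proof.
apply/torus3P.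
have /torus3P[z E] : \pi_torus3 (repr (\pi_torus3 x)) = \pi_torus3 x.
  by rewrite reprK.
by exists (A *m z); rewrite map_mxM -mulmxDr -E.
Qed.

Lemma torus3_mapM A B p :
  torus3_map A (torus3_map B p) = torus3_map (A *m B) p.
Proof. by rewrite [LHS]torus3_mapE /torus3_map map_mxM mulmxA. Qed.

Lemma torus3_map1 p : torus3_map 1%:M p = p.
Proof. by rewrite -[p]reprK torus3_mapE map_mx1 mul1mx. Qed.

Lemma torus3_map_origin A : torus3_map A torus3_origin = torus3_origin.
Proof. by rewrite torus3_mapE mulmx0. Qed.

Lemma torus3_map_continuous A : continuous (torus3_map A).
Proof.
apply/quotient_continuous.
rewrite (_ : _ \o _ = \pi_torus3 \o mulmx (map_mx intr A)); last first.
  by apply/funext => x /=; exact: torus3_mapE.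
move=> x; apply: continuous_comp; last exact: pi_continuous.
exact: mulmx_continuous.
Qed.

Definition punctured_torus3 : set torus3 := ~` [set torus3_origin].

Section monodromy.
Context (A : 'M[int]_3) (uA : A \in unitmx).

Lemma torus3_mapK : cancel (torus3_map A) (torus3_map (invmx A)).
Proof. by move=> p; rewrite torus3_mapM mulVmx// torus3_map1. Qed.

Lemma torus3_mapVK : cancel (torus3_map (invmx A)) (torus3_map A).
Proof. by move=> p; rewrite torus3_mapM mulmxV// torus3_map1. Qed.

Lemma torus3_map_punctured (p : punctured_torus3) :
  torus3_map A (set_val p) \in punctured_torus3.
Proof.
apply/mem_set => /= Ap; apply: (set_valP p).
by rewrite /= -[LHS]torus3_mapK Ap torus3_map_origin.
Qed.

Definition punctured_torus3_map (p : punctured_torus3) : punctured_torus3 :=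
  SigSub (torus3_map_punctured p).

Lemma punctured_torus3_map_continuous : continuous punctured_torus3_map.
Proof.
apply: continuous_comp_initial => p.
apply: (@continuous_comp _ _ _ set_val (torus3_map A)).
  exact: initial_continuous.
exact: torus3_map_continuous.
Qed.

End monodromy.
End torus.

Arguments punctured_torus3 : clear implicits.

Section cappell_shaneson.
Context (R : realType) (A : 'M[int]_3) (uA : A \in unitmx).

Let uVA : invmx A \in unitmx. Proof. by rewrite unitmx_inv. Qed.

Lemma punctured_torus3_mapK :
  cancel (@punctured_torus3_map R A uA) (punctured_torus3_map uVA).
Proof. by move=> p; apply: val_inj => /=; exact: torus3_mapK. Qed.

Lemma punctured_torus3_mapVK :
  cancel (@punctured_torus3_map R _ uVA) (punctured_torus3_map uA).
Proof. by move=> p; apply: val_inj => /=; exact: torus3_mapVK. Qed.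

Definition monodromy : homeo (punctured_torus3 R) (punctured_torus3 R) :=
  Homeo punctured_torus3_mapK punctured_torus3_mapVK
    (@punctured_torus3_map_continuous R _ uA)
    (@punctured_torus3_map_continuous R _ uVA).

Definition cappell_shaneson := mapping_torus R monodromy.

End cappell_shaneson.

Definition CS_matrix : 'M[int]_3 := \matrix_(i < 3, j < 3)
  nth 0 (nth [::] [:: [:: 0; 0;  1];
                      [:: 1; 0;  0];
                      [:: 0; 1; -1]] i) j.

Lemma CS_matrix_unit : CS_matrix \in unitmx.
Proof.
pose B : 'M[int]_3 := \matrix_(i < 3, j < 3)
  nth 0 (nth [::] [:: [:: 0; 1; 0]; [:: 1; 0; 1]; [:: 1; 0; 0]] i) j.
suff /mulmx1_unit[] : CS_matrix *m B = 1%:M by [].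
apply/matrixP => i j; rewrite !mxE !big_ord_recl big_ord0 !mxE.
by case: i => -[|[|[|//]]] ?; case: j => -[|[|[|//]]] ?.
Qed.

Section gluing.
Context (R : realType).

(* The point sum_i t_i v_(s_i), where v_0, ..., v_4 are the vertices of the
   standard 4-simplex (the standard basis vectors) and s is a list of four
   vertex labels. *)
Definition tetra_point (s : seq nat) (t : 'rV[R]_4) : 'rV[R]_5 :=
  \sum_(i < 4) t 0 i *: delta_mx 0 (inord (nth 0%N s i)).

(* In barycentric coordinates. *)
Definition ideal_pentachoron : set 'rV[R]_5 :=
  [set x | [/\ forall v, 0 <= x 0 v, \sum_v x 0 v = 1
             & forall v, x <> delta_mx 0 v]].

Definition green := true.
Definition red := false.

Definition two_pentachora := {c : bool & ideal_pentachoron}.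

Definition gluings : seq ((bool * seq nat) * (bool * seq nat)) :=
  [:: ((green, [:: 0; 1; 2; 4]), (green, [:: 1; 2; 3; 4]));
      ((red,   [:: 0; 1; 3; 4]), (green, [:: 0; 1; 2; 3]));
      ((red,   [:: 0; 1; 2; 4]), (green, [:: 0; 2; 3; 4]));
      ((red,   [:: 1; 2; 3; 4]), (green, [:: 0; 1; 3; 4]));
      ((red,   [:: 0; 1; 2; 3]), (red,   [:: 0; 2; 3; 4]))]%N.

(* The affine isomorphism between two tetrahedra sending the vertices s to the
   vertices s', in this order, preserves barycentric coordinates t. *)
Definition glued (x y : two_pentachora) : Prop :=
  exists2 e, e \in gluings & exists t : 'rV[R]_4,
    [/\ projT1 x = e.1.1, set_val (projT2 x) = tetra_point e.1.2 t,
        projT1 y = e.2.1 & set_val (projT2 y) = tetra_point e.2.2 t].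

Definition glued_pentachora := gen_quot glued.

End gluing.

(* Main.v *)
(* Write A for the monodromy and Gamma for the group of maps z |-> A^k z + v of
   Z^3, acting on (R^3 \ Z^3) x R with A^k shifting the last coordinate by k, so
   that CS(A) is the quotient by Gamma. Place the vertices of the two pentachora at
   G = (0, e1 - e2, e1 - e3, e3, e1) and R = (0, e1 - e3, e3, e2, e1) in Z^3. Every
   edge is then a vector A^k e1, whose exponent k is its height, and the five gluings
   are induced by elements of Gamma. Sending a point with barycentric coordinates x
   to (sum_i x_i z_i, sum_(i<j) h_ij x_i x_j / sum_(i<j) x_i x_j) defines a map from
   the glued space to CS(A), well defined on faces because it only depends on the
   weights x_i at the lattice points z_i.

   Both projected pentachora are pyramids over a parallelogram, with one-dimensional
   fibres over R^3 along which the second coordinate is strictly increasing. The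
   union of the bottom (top) faces of the level k copies is part of the image under
   A^k (A^(k+1)) of the Kuhn triangulation of R^3, where weights are determined by
   position; hence the vertical lines are tiled by these fibres, giving injectivity
   and, since the Kuhn triangulation covers R^3, surjectivity. The map is closed by
   compactness of the simplex, because a point off Z^3 stays away from the deleted
   vertices. *)

From Stdlib Require Import Relation_Operators.
Require Import Defs.
From mathcomp Require Import all_boot all_order all_algebra.
From mathcomp Require Import all_classical all_reals all_analysis.
From mathcomp Require Import ring lra zify.

Set Implicit Arguments.
Unset Strict Implicit.
Unset Printing Implicit Defensive.

Import Order.TTheory GRing.Theory Num.Theory.
Import numFieldNormedType.Exports.

Local Open Scope classical_set_scope.
Local Open Scope ring_scope.
Local Open Scope quotient_scope.

(** * Coordinates on the lattice, the monodromy matrix and the lattice vertices *)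

Definition col3 (T : nmodType) (a b c : T) : 'cV[T]_3 :=
  \col_j nth 0 [:: a; b; c] j.

Lemma col3P (T : nmodType) (u v : 'cV[T]_3) :
  u (inord 0) 0 = v (inord 0) 0 -> u (inord 1) 0 = v (inord 1) 0 ->
  u (inord 2) 0 = v (inord 2) 0 -> u = v.
Proof.
move=> h0 h1 h2; apply/matrixP => i j; rewrite ord1.
have -> : i = inord (val i) by apply: val_inj; rewrite /= inordK.
by case: i => -[|[|[|//]]].
Qed.

Lemma col3E (T : nmodType) (a b c : T) (n : nat) : (n < 3)%N ->
  col3 a b c (inord n) 0 = nth 0 [:: a; b; c] n.
Proof. by move=> n3; rewrite mxE inordK. Qed.

Lemma sum3 (V : nmodType) (F : 'I_3 -> V) :
  \sum_i F i = F (inord 0) + F (inord 1) + F (inord 2).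
Proof.
rewrite !big_ord_recl big_ord0 addr0 addrA.
by congr (F _ + F _ + F _); apply: val_inj; rewrite /= inordK.
Qed.

Lemma sum5 (V : nmodType) (F : 'I_5 -> V) :
  \sum_i F i = F (inord 0) + F (inord 1) + F (inord 2) + F (inord 3)
    + F (inord 4).
Proof.
rewrite !big_ord_recl big_ord0 addr0 !addrA.
by congr (F _ + F _ + F _ + F _ + F _); apply: val_inj; rewrite /= inordK.
Qed.

(** Taken along a ring morphism so that one computation serves both lattice vectors ([idfun]) and
    real positions ([intr]). *)
Lemma CS_mulE (T : comPzRingType) (f : {rmorphism int -> T}) (z : 'cV[T]_3) :
  map_mx f CS_matrix *m z =
  col3 (z (inord 2) 0) (z (inord 0) 0) (z (inord 1) 0 - z (inord 2) 0).
Proof.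
apply: col3P; rewrite !mxE sum3 !mxE !inordK//= ?rmorphN ?rmorph0 ?rmorph1;
  by rewrite ?mul0r ?mul1r ?mulN1r ?addr0 ?add0r.
Qed.

Lemma CS_mulzE (z : 'cV[int]_3) : CS_matrix *m z =
  col3 (z (inord 2) 0) (z (inord 0) 0) (z (inord 1) 0 - z (inord 2) 0).
Proof. by rewrite -(CS_mulE idfun) map_mx_id. Qed.

Lemma CS_unit : CS_matrix \is a GRing.unit.
Proof. exact: CS_matrix_unit. Qed.

(* The edges of both lattice pentachora are the vectors [A^k e_1], [0 <= k <= 7],
   oriented from the smaller label to the larger one. *)
Definition vtx (c : bool) (i : nat) : 'cV[int]_3 :=
  nth 0 (if c then [:: 0; col3 1 (-1) 0; col3 1 0 (-1); col3 0 0 1; col3 1 0 0]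
         else [:: 0; col3 1 0 (-1); col3 0 0 1; col3 0 1 0; col3 1 0 0]) i.

Definition place (k : int) (v z : 'cV[int]_3) : 'cV[int]_3 :=
  CS_matrix ^ k *m z + v.

Lemma place_inj k v : injective (place k v).
Proof.
move=> z z' /addIr h; have uA := unitrXz k CS_unit.
by rewrite -[z](mulKmx uA) h mulKmx.
Qed.

(** The point reflection [z |-> e_1 - z] swaps the two pentachora and reverses their labels; through
    it the red facts about weights and positions are deduced from the green ones. *)
Lemma vtx_sym c i : (i < 5)%N -> vtx (~~ c) i = vtx true 4 - vtx c (4 - i).
Proof.
case: c; case: i => [|[|[|[|[|//]]]]] _; rewrite /vtx /= ?subrr ?subr0 //;
  by apply: col3P; rewrite !mxE !inordK.
Qed.

(** * The contracting functional of the monodromy *)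

Section Reals.
Context (R : realType).
Implicit Types (x : 'rV[R]_5) (k : int) (z v : 'cV[int]_3) (c : bool).

(** The characteristic polynomial [X^3 + X^2 - 1] of the monodromy changes sign on [[0, 1]]; its
    root there is the contracting eigenvalue. *)
Lemma lam_ex : exists l : R, [/\ 0 < l, l < 1 & l ^+ 3 = 1 - l ^+ 2].
Proof.
pose p : {poly R} := 'X^3 + 'X^2 - 1.
have pE (a : R) : p.[a] = a ^+ 3 + a ^+ 2 - 1 by rewrite !hornerE.
have [|l /andP[l0 l1] /rootP] := @poly_ivt R p 0 1 ler01.
  by rewrite !pE; apply/andP; split; lra.
rewrite pE => E; exists l; split.
- by rewrite lt_neqAle l0 andbT; apply/eqP => E0; move: E; rewrite -E0; lra.
- by rewrite lt_neqAle l1 andbT; apply/eqP => E0; move: E; rewrite E0; lra.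
- lra.
Qed.

Definition lam : R := sval (cid lam_ex).
Lemma lam_gt0 : 0 < lam. Proof. by rewrite /lam; case: cid => l []. Qed.
Lemma lam_lt1 : lam < 1. Proof. by rewrite /lam; case: cid => l []. Qed.
Lemma lam3 : lam ^+ 3 = 1 - lam ^+ 2.
Proof. by rewrite /lam; case: cid => l []. Qed.

(** Pairing with the left eigenvector [(1, lam, lam^2)] of the monodromy. *)
Definition ell (z : 'cV[int]_3) : R :=
  (z (inord 0) 0)%:~R + (z (inord 1) 0)%:~R * lam
  + (z (inord 2) 0)%:~R * lam ^+ 2.

Lemma ellD z z' : ell (z + z') = ell z + ell z'.
Proof. by rewrite /ell !mxE !rmorphD /=; ring. Qed.

Lemma ellN z : ell (- z) = - ell z.
Proof. by rewrite /ell !mxE !rmorphN /=; ring. Qed.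

Lemma ellB z z' : ell (z - z') = ell z - ell z'.
Proof. by rewrite ellD ellN. Qed.

Lemma ell_CS z : ell (CS_matrix *m z) = lam * ell z.
Proof.
rewrite CS_mulzE /ell !col3E//= rmorphB /=; ring: lam3.
Qed.

Lemma lam_exp_gt0 k : 0 < lam ^ k.
Proof. exact/exprz_gt0/lam_gt0. Qed.

Lemma ell_CSX k z : ell (CS_matrix ^ k *m z) = lam ^ k * ell z.
Proof.
have H n w : ell (CS_matrix ^+ n *m w) = lam ^+ n * ell w.
  elim: n w => [|n IH] w; first by rewrite !expr0 mul1mx mul1r.
  by rewrite exprS -mulmxE -mulmxA ell_CS IH mulrA -exprS.
case: k => n; first exact: H.
rewrite !NegzE -!exprnN; apply: (mulfI (lt0r_neq0 (exprn_gt0 n.+1 lam_gt0))).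
rewrite -H mulrA divff ?mul1r ?lt0r_neq0 ?exprn_gt0 ?lam_gt0//.
have u : CS_matrix ^+ n.+1 \is a GRing.unit by rewrite unitrX// CS_unit.
by rewrite mulmxA mulmxE divrr// mul1mx.
Qed.

Lemma ell_place k v z : ell (place k v z) = lam ^ k * ell z + ell v.
Proof. by rewrite ellD ell_CSX. Qed.

(* [height c i j] is the [k] with [vtx c j - vtx c i = A^k e_1], for [i < j]. *)
Definition green_heights : seq (seq nat) :=
  [:: [:: 0; 5; 3; 2; 0]; [:: 0; 0; 6; 4; 1]; [:: 0; 0; 0; 7; 2];
      [:: 0; 0; 0; 0; 3]]%N.

Definition height c (i j : nat) : nat :=
  if c then nth 0%N (nth [::] green_heights i) j
  else nth 0%N (nth [::] green_heights (4 - j)) (4 - i).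

(** The edge is [A^k e_1] with [k] its height, and [ell e_1 = 1]. The check reduces the powers of
    [lam] up to the seventh modulo the cubic equation. Consequently [ell] increases with the
    label. *)
Lemma ell_vtx c i j : (i < j)%N -> (j < 5)%N ->
  ell (vtx c j) - ell (vtx c i) = lam ^+ height c i j.
Proof.
have l3 := lam3.
have l4 : lam ^+ 4 = lam - 1 + lam ^+ 2 by rewrite exprS l3 mulrBr -exprS l3; ring.
have l5 : lam ^+ 5 = 1 - lam by rewrite exprS l4; ring: l3.
have l6 : lam ^+ 6 = lam - lam ^+ 2 by rewrite exprS l5; ring.
have l7 : lam ^+ 7 = 2 * lam ^+ 2 - 1 by rewrite exprS l6; ring: l3.
case: c; case: j => [|[|[|[|[|//]]]]]; case: i => [|[|[|[|//]]]]// _ _;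
  rewrite /ell /= ?mxE ?inordK//= ?mulr0n ?rmorphN /= ?l3 ?l4 ?l5 ?l6 ?l7; ring.
Qed.
End Reals.

(** * Positions, levels and weights *)

Section Weights.
Context (R : realType).
Implicit Types (x y : 'rV[R]_5) (k : int) (z v : 'cV[int]_3) (c : bool).

Definition cf x (i : nat) : R := x 0 (inord i).

Definition row5 (a b c d e : R) : 'rV[R]_5 :=
  \row_j nth 0 [:: a; b; c; d; e] j.

Lemma row5E (a b c d e : R) i : (i < 5)%N ->
  cf (row5 a b c d e) i = nth 0 [:: a; b; c; d; e] i.
Proof. by move=> i5; rewrite /cf mxE inordK. Qed.

Lemma row5_ext x y : (forall i, (i < 5)%N -> cf x i = cf y i) -> x = y.
Proof.
by move=> h; apply/rowP => i; have := h i (ltn_ord i); rewrite /cf inord_val.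
Qed.

Definition vert c k v (i : nat) : 'cV[int]_3 := place k v (vtx c i).

(** The barycentric coordinates as a measure on the lattice. It forgets colour, copy and labels, so
    that being glued becomes equality of weights. *)
Definition weight c k v x z : R :=
  \sum_(i < 5) x 0 i * (vert c k v i == z)%:R.

Definition position c k v x : 'cV[R]_3 :=
  \sum_(i < 5) x 0 i *: map_mx intr (vert c k v i).

Definition ordered_pairs : seq (nat * nat) :=
  [:: (0, 1); (0, 2); (0, 3); (0, 4); (1, 2); (1, 3); (1, 4); (2, 3); (2, 4);
      (3, 4)]%N.

Definition num c x : R :=
  \sum_(e <- ordered_pairs) (height c e.1 e.2)%:R * cf x e.1 * cf x e.2.
Definition den x : R := \sum_(e <- ordered_pairs) cf x e.1 * cf x e.2.

(* The flow time of a point: the mean of the heights of the edges, weighted by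
   products of barycentric coordinates. It has no limit at the vertices. *)
Definition level c k x : R := k%:~R + num c x / den x.

Definition simplex x := (forall i, 0 <= x 0 i) /\ \sum_i x 0 i = 1.

Lemma simplex_cf x : simplex x -> forall i, 0 <= cf x i.
Proof. by case=> h _ i; apply: h. Qed.

Lemma cf_sum x : \sum_i x 0 i = cf x 0 + cf x 1 + cf x 2 + cf x 3 + cf x 4.
Proof. by rewrite sum5. Qed.

Lemma simplexP x : (forall i, (i < 5)%N -> 0 <= cf x i) ->
  cf x 0 + cf x 1 + cf x 2 + cf x 3 + cf x 4 = 1 -> simplex x.
Proof.
move=> h1 h2; split; last by rewrite cf_sum.
by move=> i; have := h1 i (ltn_ord i); rewrite /cf inord_val.
Qed.

Lemma sum5n (V : nmodType) x (F : R -> nat -> V) :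
  \sum_(i < 5) F (x 0 i) i =
  F (cf x 0) 0%N + F (cf x 1) 1%N + F (cf x 2) 2%N + F (cf x 3) 3%N
  + F (cf x 4) 4%N.
Proof. by rewrite sum5 /cf !inordK. Qed.

(** Both sides integrate [f] against the measure [weight], once the sums are taken over a common
    finite list containing both sets of vertices. *)
Lemma weight_sum (V : lmodType R) c k v x c' k' v' x' (f : 'cV[int]_3 -> V) :
  weight c k v x =1 weight c' k' v' x' ->
  \sum_(i < 5) x 0 i *: f (vert c k v i) =
  \sum_(i < 5) x' 0 i *: f (vert c' k' v' i).
Proof.
move=> E.
pose s := undup ([seq vert c k v i | i : 'I_5] ++ [seq vert c' k' v' i | i : 'I_5]).
have H c1 k1 v1 x1 : (forall i : 'I_5, vert c1 k1 v1 i \in s) ->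
  \sum_(i < 5) x1 0 i *: f (vert c1 k1 v1 i) =
  \sum_(z <- s) weight c1 k1 v1 x1 z *: f z.
  move=> sub.
  transitivity (\sum_(i < 5) \sum_(z <- s)
    (x1 0 i * (vert c1 k1 v1 i == z)%:R) *: f z).
    apply: eq_bigr => i _; rewrite (bigD1_seq _ (sub i) (undup_uniq _)) /=.
    rewrite eqxx mulr1 big1 ?addr0// => z /negPf zi.
    by rewrite eq_sym zi mulr0 scale0r.
  by rewrite exchange_big /=; apply: eq_bigr => z _; rewrite -scaler_suml.
rewrite !H; first by apply: eq_bigr => z _; rewrite E.
- move=> i; rewrite mem_undup mem_cat.
  by apply/orP; right; apply/mapP; exists i => //; rewrite mem_enum.
- move=> i; rewrite mem_undup mem_cat.
  by apply/orP; left; apply/mapP; exists i => //; rewrite mem_enum.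
Qed.

Lemma weight_position c k v x c' k' v' x' :
  weight c k v x =1 weight c' k' v' x' ->
  position c k v x = position c' k' v' x'.
Proof. exact: weight_sum. Qed.

(** For [Z = vert c k v], the integral of [f] against the square of the weight measure. Both [den]
    and the numerator of [level] have this form. *)
Definition pairing (f : 'cV[int]_3 -> 'cV[int]_3 -> R) (Z : nat -> 'cV[int]_3)
    x : R :=
  \sum_(i < 5) \sum_(j < 5) x 0 i * (x 0 j * f (Z i) (Z j)).

Lemma weight_pairing f c k v x c' k' v' x' :
  weight c k v x =1 weight c' k' v' x' ->
  pairing f (vert c k v) x = pairing f (vert c' k' v') x'.
Proof.
move=> E; rewrite /pairing.
under eq_bigr do rewrite -mulr_sumr.
under [RHS]eq_bigr do rewrite -mulr_sumr.
have inner z := @weight_sum R^o c k v x c' k' v' x' (f z) E.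
have := @weight_sum R^o c k v x c' k' v' x'
  (fun z => \sum_(j < 5) x' 0 j * f z (vert c' k' v' j)) E.
move=> <-; apply: eq_bigr => i _; congr (_ * _); exact: inner.
Qed.

Lemma ordered_pairsP e : e \in ordered_pairs -> (e.1 < e.2 < 5)%N.
Proof.
by have /allP h : all (fun e => (e.1 < e.2 < 5)%N) ordered_pairs by [];
  apply: h.
Qed.

Lemma pairingE f Z x : (forall z, f z z = 0) ->
  (forall z z', f z z' = f z' z) ->
  pairing f Z x = 2 * \sum_(e <- ordered_pairs)
    f (Z e.1) (Z e.2) * cf x e.1 * cf x e.2.
Proof.
move=> f0 fC; rewrite /pairing.
under eq_bigr do rewrite (sum5n x (fun a j => x 0 _ * (a * f _ (Z j)))).
rewrite (sum5n x (fun b i => b * (cf x 0 * f (Z i) (Z 0)) +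
  b * (cf x 1 * f (Z i) (Z 1)) + b * (cf x 2 * f (Z i) (Z 2)) +
  b * (cf x 3 * f (Z i) (Z 3)) + b * (cf x 4 * f (Z i) (Z 4)))).
rewrite unlock /= !f0 addr0.
move: (Z 0) (Z 1) (Z 2) (Z 3) (Z 4) (cf x 0) (cf x 1) (cf x 2) (cf x 3) (cf x 4).
move=> z0 z1 z2 z3 z4 x0 x1 x2 x3 x4.
rewrite (fC z1 z0) (fC z2 z0) (fC z3 z0) (fC z4 z0) (fC z2 z1) (fC z3 z1).
rewrite (fC z4 z1) (fC z3 z2) (fC z4 z2) (fC z4 z3).
move: (f z0 z1) (f z0 z2) (f z0 z3) (f z0 z4) (f z1 z2) (f z1 z3) (f z1 z4).
move: (f z2 z3) (f z2 z4) (f z3 z4) => *; ring.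
Qed.

(* The height of an edge with difference [A^k e_1] is [k]; since [ell e_1 = 1]
   and [ell] scales by [lam], it is recovered as a logarithm. *)
Definition eta (z z' : 'cV[int]_3) : R := ln `|ell R (z' - z)| / ln (lam R).

Lemma ln_exprz (a : R) k : 0 < a -> ln (a ^ k) = k%:~R * ln a.
Proof.
move=> a0; case: k => n; first by rewrite -exprnP lnXn// mulr_natl.
by rewrite NegzE -exprnN lnV ?posrE ?exprn_gt0// lnXn// rmorphN mulNr /= mulr_natl.
Qed.

Lemma ln_lam_neq0 : ln (lam R) != 0.
Proof. by rewrite lt_eqF// ln_lt0// lam_gt0 lam_lt1. Qed.

Lemma eta_vert c k v i j : (i < j)%N -> (j < 5)%N ->
  eta (vert c k v i) (vert c k v j) = k%:~R + (height c i j)%:R.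
Proof.
move=> ij j5; have l0 := lam_gt0 R.
rewrite /eta ellB !ell_place opprD addrACA subrr addr0 -mulrBr ell_vtx//.
rewrite ger0_norm ?mulr_ge0 ?ltW ?exprn_gt0 ?lam_exp_gt0//.
rewrite lnM ?posrE ?exprn_gt0 ?lam_exp_gt0// ln_exprz// lnXn//.
by rewrite -[ln _ *+ _]mulr_natl -mulrDl mulfK// ln_lam_neq0.
Qed.

(** The functional [ell] separates the vertices, since along each edge it grows by a positive power
    of [lam]. *)
Lemma vert_inj c k v i j : (i < j)%N -> (j < 5)%N ->
  vert c k v i != vert c k v j.
Proof.
move=> ij j5; apply/eqP => /place_inj E.
have := ell_vtx R c ij j5; rewrite E subrr => /esym/eqP.
by rewrite expf_eq0 (gt_eqF (lam_gt0 R)) andbF.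
Qed.

Lemma pairing_eta c k v x :
  pairing eta (vert c k v) x = 2 * (k%:~R * den x + num c x).
Proof.
rewrite pairingE; last 2 first.
(* On the diagonal [eta] is [ln 0 / ln lam], which vanishes by the convention [ln 0 = 0]. *)
- by move=> z; rewrite /eta subrr /ell !mxE !mul0r !addr0 normr0 ln0// mul0r.
- by move=> z z'; rewrite /eta -(opprB z) ellN normrN.
congr (_ * _); rewrite /den mulr_sumr -big_split /=.
apply: eq_big_seq => e /ordered_pairsP/andP[e1 e2]; rewrite eta_vert//; ring.
Qed.

Lemma pairing_neq c k v x :
  pairing (fun z z' => (z != z')%:R) (vert c k v) x = 2 * den x.
Proof.
rewrite pairingE; last 2 first.
- by move=> z; rewrite eqxx.
- by move=> z z'; rewrite eq_sym.
congr (_ * _); apply: eq_big_seq => e /ordered_pairsP/andP[e1 e2].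
by rewrite vert_inj// mul1r.
Qed.

Lemma weight_den c k v x c' k' v' x' :
  weight c k v x =1 weight c' k' v' x' -> den x = den x'.
Proof.
move/(weight_pairing (fun z z' => (z != z')%:R)); rewrite !pairing_neq.
by apply: mulfI; rewrite pnatr_eq0.
Qed.

(** The level is the quotient of the pairings of [eta] and of the indicator of distinct points, both
    determined by the weights. This makes it compatible with the gluings. *)
Lemma weight_level c k v x c' k' v' x' : den x != 0 ->
  weight c k v x =1 weight c' k' v' x' -> level c k x = level c' k' x'.
Proof.
move=> d0 E; have D := weight_den E; have d0' : den x' != 0 by rewrite -D.
move/(weight_pairing eta): E; rewrite !pairing_eta => /(mulfI _) E.
have {}E : k%:~R * den x + num c x = k'%:~R * den x' + num c' x'.
  by apply: E; rewrite pnatr_eq0.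
rewrite /level -[k%:~R](mulfK d0) -[k'%:~R](mulfK d0') -!mulrDl E D//.
Qed.

Lemma positionE c k v x :
  position c k v x = map_mx intr (CS_matrix ^ k) *m position c 0 0 x +
  (\sum_i x 0 i) *: map_mx intr v.
Proof.
rewrite /position mulmx_sumr scaler_suml -big_split /=.
apply: eq_bigr => i _.
rewrite -scalemxAr -scalerDr; congr (_ *: _).
by rewrite /vert /place expr0z mul1mx addr0 map_mxD map_mxM.
Qed.

Lemma position0E c x : position c 0 0 x =
  if c then col3 (cf x 1 + cf x 2 + cf x 4) (- cf x 1) (cf x 3 - cf x 2)
  else col3 (cf x 1 + cf x 4) (cf x 3) (cf x 2 - cf x 1).
Proof.
have H (j : 'I_3) : position c 0 0 x j 0 =
    cf x 0 * (vtx c 0 j 0)%:~R + cf x 1 * (vtx c 1 j 0)%:~R +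
    cf x 2 * (vtx c 2 j 0)%:~R + cf x 3 * (vtx c 3 j 0)%:~R +
    cf x 4 * (vtx c 4 j 0)%:~R.
  rewrite /position summxE -(sum5n x (fun a i => a * (vtx c i j 0)%:~R)).
  by apply: eq_bigr => i _; rewrite /vert /place expr0z mul1mx addr0 !mxE.
by case: c H => H; apply: col3P; rewrite H /vtx /= !mxE !inordK//=; ring.
Qed.

(** If [den] vanished, all products of two different coordinates would, leaving a single non-zero
    coordinate, hence a vertex. *)
Lemma den_gt0 x : simplex x -> (forall i, x <> delta_mx 0 i) -> 0 < den x.
Proof.
move=> sx nv; have x0 := simplex_cf sx.
have d0 : 0 <= den x by apply: sumr_ge0 => e _; apply: mulr_ge0.
rewrite lt_neqAle d0 andbT; apply/negP => /eqP/esym d00.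
have E i j : (i < j)%N -> (j < 5)%N -> cf x i = 0 \/ cf x j = 0.
  move=> ij j5; have : (i, j) \in ordered_pairs.
    by case: j ij j5 => [|[|[|[|[|//]]]]]; case: i => [|[|[|[|//]]]].
  move=> ein; move/eqP: d00; rewrite psumr_eq0; last first.
    by move=> e _; apply: mulr_ge0.
  move/allP/(_ _ ein) => /= /eqP/eqP; rewrite mulf_eq0.
  by case/orP => /eqP; [left|right].
have [i i0] : exists i, cf x i != 0.
  apply: contrapT => h; have z i : cf x i = 0.
    by apply: contrapT => /eqP hi; apply: h; exists i.
  by case: sx => _; rewrite cf_sum !z !addr0 => /esym/eqP; rewrite oner_eq0.
pose o : 'I_5 := inord i.
have xj j : j != o -> x 0 j = 0.
  move=> jo; have xE l : x 0 l = cf x l by rewrite /cf inord_val.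
  have : cf x o != 0 by rewrite /cf inord_val.
  case: (ltngtP j o) => [lt|lt|/val_inj/eqP]; last by rewrite (negPf jo).
    by case: (E _ _ lt (ltn_ord _)); rewrite -xE// => ->; rewrite eqxx.
  by case: (E _ _ lt (ltn_ord _)); rewrite -!xE// => ->; rewrite eqxx.
apply: (nv o); apply/rowP => j; rewrite !mxE eqxx /=.
case: eqP => [->|/eqP jo]; last exact: xj.
by case: sx => _ <-; rewrite (bigD1 o)//= [X in _ + X]big1 ?addr0// => l /xj.
Qed.

Lemma num_ge0 c x : simplex x -> 0 <= num c x.
Proof.
by move=> sx; apply: sumr_ge0 => e _; rewrite !mulr_ge0 ?simplex_cf.
Qed.

Lemma num_le c x : simplex x -> num c x <= 7 * den x.
Proof.
move=> sx; rewrite /num /den mulr_sumr; apply: ler_sum => e _.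
rewrite -mulrA ler_wpM2r// ?mulr_ge0 ?simplex_cf// ler_nat.
by case: c; case: e => [[|[|[|[|[|?]]]]] [|[|[|[|[|?]]]]]] //=;
  rewrite /height /= ?nth_nil ?nth_default.
Qed.

(** All heights lie between 0 and 7. Only finitely many [k] can therefore produce a given time. *)
Lemma level_bounds c k x : simplex x -> 0 < den x ->
  k%:~R <= level c k x <= k%:~R + 7.
Proof.
move=> sx d0; rewrite /level lerDl lerD2l ler_pdivrMr// num_le// andbT.
by rewrite divr_ge0 ?num_ge0// ltW.
Qed.

End Weights.

(** * The vertical flow *)

Section Flow.
Context (R : realType).
Implicit Types (x y : 'rV[R]_5) (k : int) (z v : 'cV[int]_3) (c : bool).

(* [direction c] spans the barycentric directions along which the position is
   constant; [lo c] and its successor are the labels with coefficient 1. *)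
Definition lo c : nat := if c then 2 else 1.

Definition direction c : 'rV[R]_5 :=
  if c then row5 (-1) 0 1 1 (-1) else row5 (-1) 1 1 0 (-1).

Definition flow c (s : R) x : 'rV[R]_5 := x + s *: direction c.

(** How far a point can flow inside the simplex: backwards for [depth], forwards for [room]. *)
Definition depth c x : R := Num.min (cf x (lo c)) (cf x (lo c).+1).
Definition room x : R := Num.min (cf x 0) (cf x 4).

Lemma flowE c s x i : cf (flow c s x) i = cf x i + s * cf (direction c) i.
Proof. by rewrite /cf /flow !mxE. Qed.

Lemma flow0 c x : flow c 0 x = x.
Proof. by rewrite /flow scale0r addr0. Qed.

Lemma cf_direction c i : (i < 5)%N ->
  cf (direction c) i = nth 0 (if c then [:: -1; 0; 1; 1; -1]
                              else [:: -1; 1; 1; 0; -1]) i.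
Proof. by rewrite /direction; case: c; exact: row5E. Qed.

Lemma simplex_flow c s x : simplex x -> - depth c x <= s <= room x ->
  simplex (flow c s x).
Proof.
move=> sx; have x0 := simplex_cf sx; have := cf_sum x.
rewrite (proj2 sx) /depth /room lerNl !le_min => /esym x1.
move=> /andP[/andP[s1 s2] /andP[s3 s4]].
have y i : (i < 5)%N -> cf (flow c s x) i = cf x i + s *
    nth 0 (if c then [:: -1; 0; 1; 1; -1] else [:: -1; 1; 1; 0; -1]) i.
  by move=> i5; rewrite flowE cf_direction.
have := (x0 0%N, x0 1%N, x0 2%N, x0 3%N, x0 4%N) => -[[[[a b] d] e] f].
apply: simplexP => [i i5|]; last by rewrite !y//; case: (c) => /=; lra.
rewrite y//; case: c s1 s2 {y} => /= s1 s2.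
  by case: i i5 => [|[|[|[|[|//]]]]] _ /=; lra.
by case: i i5 => [|[|[|[|[|//]]]]] _ /=; lra.
Qed.

(** The change of weight per unit of flow. It is the same for both colours, because both pyramids
    stand on the parallelogram [0, e_1 - e_3, e_1, e_3], whose diagonals give the affine relation
    behind [direction]. *)
Definition shift k v z : R :=
  (place k v (col3 0 0 1) == z)%:R + (place k v (col3 1 0 (-1)) == z)%:R
  - (place k v 0 == z)%:R - (place k v (col3 1 0 0) == z)%:R.

Lemma weight_flow c k v s x z :
  weight c k v (flow c s x) z = weight c k v x z + s * shift k v z.
Proof.
have -> : shift k v z = weight c k v (direction c) z.
  rewrite /weight (sum5n _ (fun a i => a * (vert c k v i == z)%:R)).
  rewrite !cf_direction// /shift.
  have E (a b d e f : R) :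
      b + d - a - f = -1 * a + 0 * e + 1 * d + 1 * b + -1 * f by ring.
  have E' (a b d e f : R) :
      b + d - a - f = -1 * a + 1 * d + 1 * b + 0 * e + -1 * f by ring.
  by case: c; [exact: E|exact: E'].
rewrite /weight mulr_sumr -big_split /=; apply: eq_bigr => i _.
by rewrite !mxE mulrDl mulrA.
Qed.

Lemma position_flow c k v s x :
  position c k v (flow c s x) = position c k v x.
Proof.
rewrite !(positionE c k v) !cf_sum !flowE !cf_direction//.
congr (_ *m _ + _ *: _); last by case: c => /=; ring.
rewrite !position0E !flowE !cf_direction//.
by case: c => /=; congr col3; ring.
Qed.

(** Within one copy the vertices are distinct, so the weight at a vertex is the coordinate
    itself. *)
Lemma flow_inj_weight c k v x y : weight c k v x =1 weight c k v y -> x = y.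
Proof.
move=> E; apply/rowP => i.
have wi x' : weight c k v x' (vert c k v i) = x' 0 i.
  rewrite /weight (bigD1 i)//= eqxx mulr1 big1 ?addr0// => j ji.
  case: (ltngtP i j) => [lt|lt|/val_inj/esym/eqP]; last by rewrite (negPf ji).
    by rewrite eq_sym (negPf (vert_inj R c k v lt (ltn_ord _))) mulr0.
  by rewrite (negPf (vert_inj R c k v lt (ltn_ord _))) mulr0.
by have := E (vert c k v i); rewrite !wi.
Qed.

(* Along the flow, [num c y * den x - num c x * den y] is a polynomial with
   nonnegative coefficients in the step and the coordinates of both ends. *)
Lemma num_flow x s : simplex x -> 0 < s -> s <= room x ->
  num true x * den (flow true s x) < num true (flow true s x) * den x.
Proof.
move=> sx s0; rewrite /room le_min => /andP[s1 s2].
have x0 := simplex_cf sx.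
rewrite /num /den unlock /= /height /= !flowE !cf_direction//=.
have := (x0 3%N, x0 2%N, x0 1%N) => -[[+ +] +].
(* Coordinates 0 and 4 are expressed through their values at the far end, the others through those
   at the near end, so that all variables are nonnegative. *)
have -> : cf x 0 = (cf x 0 - s) + s by ring.
have -> : cf x 4 = (cf x 4 - s) + s by ring.
have : 0 <= cf x 0 - s by rewrite subr_ge0.
have : 0 <= cf x 4 - s by rewrite subr_ge0.
move: (cf x 0 - s) (cf x 4 - s) (cf x 1) (cf x 2) (cf x 3) => a b p d c b0 a0 c0 d0 p0.
rewrite -subr_gt0.
pose Q1 := 18 * c * d * p + 12 * a * c * p + 10 * a * d * p + 9 * c * c * d +
  9 * c * d * d + 8 * a * b * p + 8 * b * c * p + 8 * d * d * p +
  7 * a * b * c + 7 * a * b * d + 7 * a * c * d + 7 * b * c * d +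
  6 * b * d * p + 6 * c * c * p + 5 * a * a * b + 5 * a * b * b +
  5 * a * d * d + 5 * b * c * c + 4 * a * c * c + 4 * a * p * p +
  4 * b * b * p + 4 * b * d * d + 4 * b * p * p + 4 * c * p * p +
  4 * d * p * p + 3 * a * a * c + 3 * b * b * d + 2 * a * a * d +
  2 * b * b * c.
pose Q2 := 25 * c * d + 25 * c * p + 25 * d * p + 17 * a * b + 15 * a * p +
  15 * b * p + 14 * a * c + 14 * a * d + 14 * b * c + 14 * b * d + 9 * c * c +
  9 * d * d + 8 * p * p + 5 * a * a + 5 * b * b.
pose Q3 := 18 * p + 16 * c + 16 * d + 12 * a + 12 * b.
(* Strictness rests on the term [7 * s ^+ 3] alone, since [Q1], [Q2] and [Q3] may vanish. *)
rewrite (_ : _ - _ = s * (Q1 + s * Q2 + s ^+ 2 * Q3 + 7 * s ^+ 3)); last first.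
  by rewrite /Q1 /Q2 /Q3; ring.
have Q1_ge0 : 0 <= Q1 by rewrite /Q1 !addr_ge0// !mulr_ge0.
have Q2_ge0 : 0 <= Q2 by rewrite /Q2 !addr_ge0// !mulr_ge0.
have Q3_ge0 : 0 <= Q3 by rewrite /Q3 !addr_ge0// !mulr_ge0.
clearbody Q1 Q2 Q3; apply: mulr_gt0 => //.
apply: ltr_wpDl; last by rewrite mulr_gt0 ?exprn_gt0.
have {}s0 := ltW s0; by rewrite !addr_ge0// mulr_ge0// exprn_ge0.
Qed.

(** The symmetry of [vtx_sym] on barycentric coordinates. Combined with exchanging the colours it
    preserves heights and commutes with the flow. *)
Definition reverse x : 'rV[R]_5 := row5 (cf x 4) (cf x 3) (cf x 2) (cf x 1) (cf x 0).

Lemma reverseE x i : (i < 5)%N -> cf (reverse x) i = cf x (4 - i).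
Proof.
by move=> i5; rewrite row5E//; case: i i5 => [|[|[|[|[|//]]]]].
Qed.

Lemma reverseK : involutive reverse.
Proof.
by move=> x; apply: row5_ext => i i5; rewrite !reverseE ?subKn// ltnS leq_subr.
Qed.

Lemma simplex_reverse x : simplex x -> simplex (reverse x).
Proof.
move=> sx; apply: simplexP => [i i5|]; first by rewrite reverseE// simplex_cf.
by case: sx => _; rewrite !reverseE// cf_sum => <-; rewrite /subn /=; ring.
Qed.

Lemma flow_reverse c s x : flow (~~ c) s (reverse x) = reverse (flow c s x).
Proof.
apply: row5_ext => i i5.
rewrite reverseE// !flowE reverseE// !cf_direction ?ltnS ?leq_subr//.
by congr (_ + _ * _); case: c; case: i i5 => [|[|[|[|[|//]]]]].
Qed.

Lemma den_reverse x : den (reverse x) = den x.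
Proof. by rewrite /den unlock /= !reverseE// /subn /=; ring. Qed.

Lemma num_reverse c x : num (~~ c) (reverse x) = num c x.
Proof.
by rewrite /num unlock /= !reverseE// /height; case: c; rewrite /subn /=; ring.
Qed.

Lemma room_reverse x : room (reverse x) = room x.
Proof. by rewrite /room !reverseE// minC. Qed.

(** After clearing denominators the green case is [num_flow]; the red case is carried to it by
    [reverse]. *)
Lemma level_flow c k x s : simplex x -> 0 < s -> s <= room x ->
  0 < den x -> 0 < den (flow c s x) -> level c k x < level c k (flow c s x).
Proof.
move=> sx s0 sr d0 d1; rewrite /level ltrD2l ltr_pdivrMr// mulrAC ltr_pdivlMr//.
case: c d1 => d1; first exact: num_flow.
rewrite -(den_reverse x) -(den_reverse (flow _ _ _)) -(num_reverse _ x).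
rewrite -(num_reverse _ (flow _ _ _)) -flow_reverse; apply: num_flow => //.
  exact: simplex_reverse.
by rewrite room_reverse.
Qed.

End Flow.

(** * The Kuhn triangulation *)

Section Hat.
Context (R : realType).
Implicit Types (x y : 'rV[R]_5) (k : int) (z v : 'cV[int]_3) (c : bool).

(* The hat function of the Kuhn (Freudenthal) triangulation of [R^3]. *)
Definition kuhn_hat (u v w : R) : R :=
  Num.max 0 (1 - (Num.max (Num.max u v) (Num.max w 0)
                  - Num.min (Num.min u v) (Num.min w 0))).

Lemma kuhn_hatE (u v w M m : R) :
  [&& m <= u, m <= v, m <= w & m <= 0] ->
  [&& u <= M, v <= M, w <= M & 0 <= M] ->
  [|| M <= u, M <= v, M <= w | M <= 0] ->
  [|| u <= m, v <= m, w <= m | 0 <= m] ->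
  kuhn_hat u v w = Num.max 0 (1 - (M - m)).
Proof.
move=> /and4P[m1 m2 m3 m4] /and4P[M1 M2 M3 M4] h1 h2.
congr (Num.max 0 (1 - (_ - _))); apply/le_anti/andP; split.
- by rewrite !ge_max M1 M2 M3.
- by rewrite !le_max; case/or4P: h1 => ->; rewrite ?orbT.
- by rewrite !ge_min; case/or4P: h2 => ->; rewrite ?orbT.
- by rewrite !le_min m1 m2 m3.
Qed.

(** Each alternative forces the spread of [u, v, w, 0] to be at least 1. *)
Lemma kuhn_hat0 (u v w : R) :
  [|| 1 <= u, 1 <= v, 1 <= w, u <= -1, v <= -1 | w <= -1]
  || [|| 1 <= u - v, 1 <= v - u, 1 <= v - w, 1 <= w - v, 1 <= u - w
      | 1 <= w - u] ->
  kuhn_hat u v w = 0.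
Proof.
move=> h; apply/max_idPl; rewrite subr_le0.
set M := Num.max _ _; set m := Num.min _ _.
have [m1 m2 m3 m4] : [/\ m <= u, m <= v, m <= w & m <= 0].
  by rewrite /m !ge_min !lexx ?orbT.
have [M1 M2 M3 M4] : [/\ u <= M, v <= M, w <= M & 0 <= M].
  by rewrite /M !le_max !lexx ?orbT.
have {}h : [|| 1 <= u, 1 <= v, 1 <= w, u <= -1, v <= -1, w <= -1,
  1 <= u - v, 1 <= v - u, 1 <= v - w, 1 <= w - v, 1 <= u - w | 1 <= w - u].
  by move: h; rewrite -!orbA.
by move: h; do 11!(case/orP; [lra|]); lra.
Qed.

Lemma kuhn_hatN (u v w : R) : kuhn_hat (- u) (- v) (- w) = kuhn_hat u v w.
Proof.
rewrite /kuhn_hat -oppr0 -!oppr_min -!oppr_max oppr0.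
by congr (Num.max 0 (1 - _)); rewrite opprK addrC.
Qed.

Lemma kuhn_hatC (u v w : R) : kuhn_hat u w v = kuhn_hat u v w.
Proof.
rewrite /kuhn_hat; congr (Num.max 0 (1 - (_ - _))).
  by rewrite -!maxA [Num.max w (Num.max _ _)]maxCA.
by rewrite -!minA [Num.min w (Num.min _ _)]minCA.
Qed.

Lemma kuhn_hatCA (u v w : R) : kuhn_hat u v w = kuhn_hat v w u.
Proof.
rewrite [RHS]kuhn_hatC /kuhn_hat; congr (Num.max 0 (1 - (_ - _))).
  by rewrite [Num.max v u]maxC.
by rewrite [Num.min v u]minC.
Qed.

Lemma int_near_01 (m : int) :
  [\/ (m%:~R : R) <= -1, m = 0, m = 1 | 2 <= (m%:~R : R)].
Proof.
have [h|[h|[h|h]]] : (m <= -1 \/ m = 0 \/ m = 1 \/ 2 <= m)%R by lia.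
- by constructor 1; rewrite -(ler_int R) in h.
- by constructor 2.
- by constructor 3.
- by constructor 4; rewrite -(ler_int R) in h.
Qed.

(** The point [(b + c + d, c + d, d)] lies in the Kuhn simplex of the chain
    [(0,0,0), (1,0,0), (1,1,0), (1,1,1)] with barycentric coordinates [a, b, c, d], which the hats
    centred at lattice points recover. Centres with an entry other than 0 or 1 are too far away; the
    remaining eight are checked one by one. *)
Lemma kuhn_hat_chain (a b c d : R) (l m n : int) :
  0 <= a -> 0 <= b -> 0 <= c -> 0 <= d -> a + b + c + d = 1 ->
  kuhn_hat (b + c + d - l%:~R) (c + d - m%:~R) (d - n%:~R) =
  a * [&& l == 0, m == 0 & n == 0]%:R + b * [&& l == 1, m == 0 & n == 0]%:R +
  c * [&& l == 1, m == 1 & n == 0]%:R + d * [&& l == 1, m == 1 & n == 1]%:R.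
Proof.
move=> a0 b0 c0 d0 s1.
have far (k : int) : ((k%:~R : R) <= -1 \/ 2 <= (k%:~R : R)) ->
  (k == 0) = false /\ (k == 1) = false.
  by move=> [h|h]; split; apply/eqP => E; move: h; rewrite E; lra.
have out (t : R) (k : int) : 0 <= t -> t <= 1 ->
    ((k%:~R : R) <= -1 \/ 2 <= (k%:~R : R)) ->
    1 <= t - k%:~R \/ t - k%:~R <= -1.
  by move=> t0 t1 [h|h]; [left|right]; lra.
have L : ((l%:~R : R) <= -1 \/ 2 <= (l%:~R : R)) \/ (l = 0 \/ l = 1).
  by case: (int_near_01 l); tauto.
have M : ((m%:~R : R) <= -1 \/ 2 <= (m%:~R : R)) \/ (m = 0 \/ m = 1).
  by case: (int_near_01 m); tauto.
have N : ((n%:~R : R) <= -1 \/ 2 <= (n%:~R : R)) \/ (n = 0 \/ n = 1).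
  by case: (int_near_01 n); tauto.
case: L => [h|L].
  have [-> ->] := far _ h; rewrite kuhn_hat0 /=; first by rewrite !mulr0 !addr0.
  by have [||->|->] := out (b + c + d) _ _ _ h; rewrite ?orbT//; lra.
case: M => [h|M].
  have [-> ->] := far _ h; rewrite kuhn_hat0 /=.
    by rewrite !andbF !mulr0 !addr0.
  by have [||->|->] := out (c + d) _ _ _ h; rewrite ?orbT//; lra.
case: N => [h|N].
  have [-> ->] := far _ h; rewrite kuhn_hat0 /=.
    by rewrite !andbF !mulr0 !addr0.
  by have [||->|->] := out d _ _ _ h; rewrite ?orbT//; lra.
have V (M' m' w : R) : w = 1 - (M' - m') -> 0 <= w ->
  Num.max 0 (1 - (M' - m')) = w.
  by move=> <- w0; apply/max_idPr.
case: L => ->; case: M => ->; case: N => -> /=;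
  rewrite ?mulr0 ?mulr1 ?addr0 ?add0r ?subr0 ?mulr1z.
- rewrite (@kuhn_hatE _ _ _ (b + c + d) 0); [apply: V; lra|lra..].
- by apply: kuhn_hat0; lra.
- by apply: kuhn_hat0; lra.
- by apply: kuhn_hat0; lra.
- rewrite (@kuhn_hatE _ _ _ (c + d) (- a)); [apply: V; lra|lra..].
- by apply: kuhn_hat0; lra.
- rewrite (@kuhn_hatE _ _ _ d (- a - b)); [apply: V; lra|lra..].
- rewrite (@kuhn_hatE _ _ _ 0 (d - 1)); [apply: V; lra|lra..].
Qed.

(** The Kuhn hat after a unimodular change of coordinates, chosen so that the bottom facets of the
    green pentachoron become chains. *)
Definition hat (p : 'cV[R]_3) : R :=
  kuhn_hat (p (inord 0) 0) (p (inord 0) 0 + p (inord 1) 0) (- p (inord 2) 0).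

Lemma hatN p : hat (- p) = hat p.
Proof. by rewrite /hat !mxE -opprD kuhn_hatN. Qed.

Lemma col3_eq (T : nmodType) (u v : 'cV[T]_3) : (u == v) =
  [&& u (inord 0) 0 == v (inord 0) 0, u (inord 1) 0 == v (inord 1) 0
    & u (inord 2) 0 == v (inord 2) 0].
Proof.
apply/eqP/and3P => [->//|[/eqP h0 /eqP h1 /eqP h2]]; exact: col3P.
Qed.

(** The facets where flow lines enter ([bottom]) and leave ([top]). Labels 0 and 4 have coefficient
    -1 in [direction] for both colours, so [top] needs no colour. *)
Definition bottom c x := (cf x (lo c) == 0) || (cf x (lo c).+1 == 0).
Definition top x := (cf x 0 == 0) || (cf x 4 == 0).

Lemma weight0E c x z : weight c 0 0 x z =
  cf x 0 * (vtx c 0 == z)%:R + cf x 1 * (vtx c 1 == z)%:R +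
  cf x 2 * (vtx c 2 == z)%:R + cf x 3 * (vtx c 3 == z)%:R +
  cf x 4 * (vtx c 4 == z)%:R.
Proof.
rewrite -(sum5n x (fun a i => a * (vtx c i == z)%:R)); apply: eq_bigr => i _.
by rewrite /vert /place expr0z mul1mx addr0.
Qed.

(** Both bottom facets are Kuhn simplices: up to translation and a permutation of the coordinates,
    their vertices form a chain in the order 3, 0, 1, 4 when coordinate 2 vanishes and 0, 1, 4, 2
    when coordinate 3 vanishes. *)
Lemma green_bottom x z : simplex x -> bottom true x ->
  weight true 0 0 x z = hat (position true 0 0 x - map_mx intr z).
Proof.
move=> sx; have x0 := simplex_cf sx; have := cf_sum x; rewrite (proj2 sx).
rewrite weight0E position0E /hat /vtx /= !col3_eq !mxE !inordK//= => /esym x1.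
move: (z _ _) (z _ _) (z _ _) => r q p.
case/orP => /eqP/= E; rewrite /lo in E; move: x1; rewrite E => x1.
  have := kuhn_hat_chain (1 - r) p (p + q)
    (x0 3%N) (x0 0%N) (x0 1%N) (x0 4%N) ltac:(lra).
  rewrite (_ : [&& 1 - r == 0, p == 0 & p + q == 0] =
    [&& 0 == p, 0 == q & 1 == r]); last by lia.
  rewrite (_ : [&& 1 - r == 1, p == 0 & p + q == 0] =
    [&& 0 == p, 0 == q & 0 == r]); last by lia.
  rewrite (_ : [&& 1 - r == 1, p == 1 & p + q == 0] =
    [&& 1 == p, -1 == q & 0 == r]); last by lia.
  rewrite (_ : [&& 1 - r == 1, p == 1 & p + q == 1] =
    [&& 1 == p, 0 == q & 0 == r]); last by lia.
  rewrite kuhn_hatCA rmorphB rmorphD /= => H.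
  rewrite (_ : kuhn_hat _ _ _ = kuhn_hat (cf x 1 + cf x 4 - p%:~R)
    (cf x 4 - (p%:~R + q%:~R)) (cf x 0 + cf x 1 + cf x 4 - (1 - r%:~R))).
    by rewrite H; ring.
  by congr kuhn_hat; lra.
have := kuhn_hat_chain p (p + q) (- r)
  (x0 0%N) (x0 1%N) (x0 4%N) (x0 2%N) ltac:(lra).
rewrite (_ : [&& p == 0, p + q == 0 & - r == 0] =
  [&& 0 == p, 0 == q & 0 == r]); last by lia.
rewrite (_ : [&& p == 1, p + q == 0 & - r == 0] =
  [&& 1 == p, -1 == q & 0 == r]); last by lia.
rewrite (_ : [&& p == 1, p + q == 1 & - r == 0] =
  [&& 1 == p, 0 == q & 0 == r]); last by lia.
rewrite (_ : [&& p == 1, p + q == 1 & - r == 1] =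
  [&& 1 == p, 0 == q & -1 == r]); last by lia.
rewrite rmorphN rmorphD /= => H.
rewrite (_ : kuhn_hat _ _ _ = kuhn_hat (cf x 1 + cf x 4 + cf x 2 - p%:~R)
  (cf x 4 + cf x 2 - (p%:~R + q%:~R)) (cf x 2 - - r%:~R)).
  by rewrite H; ring.
by congr kuhn_hat; lra.
Qed.

Definition CS_inv (p : 'cV[R]_3) : 'cV[R]_3 :=
  col3 (p (inord 1) 0) (p (inord 0) 0 + p (inord 2) 0) (p (inord 0) 0).

(** The top facets become Kuhn simplices after the inverse monodromy, with chains 1, 2, 4, 3 when
    coordinate 0 vanishes and 1, 2, 0, 3 when coordinate 4 vanishes. *)
Lemma green_top x z : simplex x -> top x ->
  weight true 0 0 x z = hat (CS_inv (position true 0 0 x - map_mx intr z)).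
Proof.
move=> sx; have x0 := simplex_cf sx; have := cf_sum x; rewrite (proj2 sx).
rewrite weight0E position0E /hat /CS_inv /vtx /= !col3E// !col3_eq !mxE !inordK//=.
move=> /esym x1.
move: (z _ _) (z _ _) (z _ _) => r q p.
case/orP => /eqP E; move: x1; rewrite E => x1.
  have := kuhn_hat_chain (q + 1) (q + (p + r)) (1 - p)
    (x0 1%N) (x0 2%N) (x0 4%N) (x0 3%N) ltac:(lra).
  rewrite (_ : [&& q + 1 == 0, q + (p + r) == 0 & 1 - p == 0] =
    [&& 1 == p, -1 == q & 0 == r]); last by lia.
  rewrite (_ : [&& q + 1 == 1, q + (p + r) == 0 & 1 - p == 0] =
    [&& 1 == p, 0 == q & -1 == r]); last by lia.
  rewrite (_ : [&& q + 1 == 1, q + (p + r) == 1 & 1 - p == 0] =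
    [&& 1 == p, 0 == q & 0 == r]); last by lia.
  rewrite (_ : [&& q + 1 == 1, q + (p + r) == 1 & 1 - p == 1] =
    [&& 0 == p, 0 == q & 1 == r]); last by lia.
  rewrite rmorphB !rmorphD /= => H.
  rewrite (_ : kuhn_hat _ _ _ = kuhn_hat (cf x 2 + cf x 4 + cf x 3 - (q%:~R + 1))
    (cf x 4 + cf x 3 - (q%:~R + (p%:~R + r%:~R))) (cf x 3 - (1 - p%:~R))).
    by rewrite H; ring.
  by congr kuhn_hat; lra.
have := kuhn_hat_chain (q + 1) (1 - p) (q + (p + r))
  (x0 1%N) (x0 2%N) (x0 0%N) (x0 3%N) ltac:(lra).
rewrite (_ : [&& q + 1 == 0, 1 - p == 0 & q + (p + r) == 0] =
  [&& 1 == p, -1 == q & 0 == r]); last by lia.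
rewrite (_ : [&& q + 1 == 1, 1 - p == 0 & q + (p + r) == 0] =
  [&& 1 == p, 0 == q & -1 == r]); last by lia.
rewrite (_ : [&& q + 1 == 1, 1 - p == 1 & q + (p + r) == 0] =
  [&& 0 == p, 0 == q & 0 == r]); last by lia.
rewrite (_ : [&& q + 1 == 1, 1 - p == 1 & q + (p + r) == 1] =
  [&& 0 == p, 0 == q & 1 == r]); last by lia.
rewrite kuhn_hatC rmorphB !rmorphD /= => H.
rewrite (_ : kuhn_hat _ _ _ = kuhn_hat (cf x 2 + cf x 0 + cf x 3 - (q%:~R + 1))
  (cf x 3 - (q%:~R + (p%:~R + r%:~R))) (cf x 0 + cf x 3 - (1 - p%:~R))).
  by rewrite H; ring.
by congr kuhn_hat; lra.
Qed.

Lemma position_reverse x : \sum_i x 0 i = 1 ->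
  position false 0 0 x = map_mx intr (col3 1 0 0) - position true 0 0 (reverse x).
Proof.
rewrite cf_sum !position0E !reverseE// /subn /= => x1.
by apply: col3P; rewrite !mxE !inordK//= ?mulr0z ?mulr1z; lra.
Qed.

Lemma weight_reverse x z :
  weight false 0 0 x z = weight true 0 0 (reverse x) (col3 1 0 0 - z).
Proof.
rewrite !weight0E !reverseE// /subn /=.
have H i : (i < 5)%N ->
    (vtx false i == z) = (vtx true (4 - i) == col3 1 0 0 - z).
  move=> i5; rewrite (vtx_sym true i5); apply/eqP/eqP => [<-|->].
    by rewrite opprB addrCA subrr addr0.
  by rewrite opprB addrCA subrr addr0.
rewrite !H// /subn /=.
move: (_ == _)%:R (_ == _)%:R (_ == _)%:R (_ == _)%:R (_ == _)%:R => *; ring.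
Qed.

Lemma CS_invN p : CS_inv (- p) = - CS_inv p.
Proof. by apply: col3P; rewrite !mxE !inordK//= opprD. Qed.

(** The red case follows from the green one by the point reflection, since [hat] is even. *)
Lemma weight0_bottom c x z : simplex x -> bottom c x ->
  weight c 0 0 x z = hat (position c 0 0 x - map_mx intr z).
Proof.
case: c => sx bx; first exact: green_bottom.
rewrite weight_reverse green_bottom//; last 2 first.
- exact: simplex_reverse.
- by move: bx; rewrite /bottom /lo !reverseE// orbC.
rewrite position_reverse ?(proj2 sx)// -hatN; congr hat.
by rewrite map_mxB opprB -!addrA; congr (_ + _); rewrite addrC.
Qed.

Lemma weight0_top c x z : simplex x -> top x ->
  weight c 0 0 x z = hat (CS_inv (position c 0 0 x - map_mx intr z)).
Proof.
case: c => sx bx; first exact: green_top.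
rewrite weight_reverse green_top//; last 2 first.
- exact: simplex_reverse.
- by move: bx; rewrite /top !reverseE// orbC.
rewrite position_reverse ?(proj2 sx)// -hatN -CS_invN; congr (hat (CS_inv _)).
by rewrite map_mxB opprB -!addrA; congr (_ + _); rewrite addrC.
Qed.

Lemma weight_place c k v x z : weight c k v x z =
  weight c 0 0 x (CS_matrix ^ (- k) *m (z - v)).
Proof.
rewrite /weight; apply: eq_bigr => i _; congr (_ * _%:R); congr nat_of_bool.
have cancelX (a b : int) (w : 'cV[int]_3) : a + b = 0 ->
    CS_matrix ^ a *m (CS_matrix ^ b *m w) = w.
  by move=> ab; rewrite mulmxA mulmxE -exprzDr ?CS_unit// ab expr0z mul1mx.
rewrite /vert /place expr0z mul1mx addr0; apply/eqP/eqP => [<-|->].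
  by rewrite addrK cancelX// addNr.
by rewrite cancelX ?subrr// subrK.
Qed.

(* Barycentric coordinates of [p] in the image under [A^k] of the Kuhn
   triangulation. *)
Definition kuhn k (p : 'cV[R]_3) z : R :=
  hat (map_mx intr (CS_matrix ^ (- k)) *m (p - map_mx intr z)).

Lemma kuhn_arg c k v x z : \sum_i x 0 i = 1 ->
  map_mx intr (CS_matrix ^ (- k)) *m (position c k v x - map_mx intr z) =
  position c 0 0 x - map_mx intr (CS_matrix ^ (- k) *m (z - v)).
Proof.
move=> x1; rewrite positionE x1 scale1r map_mxM map_mxB.
rewrite -addrA mulmxDr mulmxA -map_mxM mulmxE -exprzDr ?CS_unit// addNr expr0z.
by rewrite map_mx1 mul1mx; congr (_ + _); rewrite -mulmxN opprB.
Qed.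

(** Equivariance reduces this to [k = 0], [v = 0]. On bottom facets of copies with the same [k], the
    position alone thus determines the weights, whatever the colour and the translation. *)
Lemma weight_bottom c k v x : simplex x -> bottom c x ->
  weight c k v x =1 kuhn k (position c k v x).
Proof.
move=> sx bx z; rewrite weight_place weight0_bottom//.
by rewrite /kuhn kuhn_arg// (proj2 sx).
Qed.

Lemma CS_invE p : map_mx intr (CS_matrix ^ (-1)) *m p = CS_inv p.
Proof.
have := CS_mulE intr (CS_inv p); rewrite !col3E//= => E.
rewrite {1}(_ : p = map_mx intr (CS_matrix ^ 1) *m CS_inv p); last first.
  by rewrite expr1z E; apply: col3P; rewrite col3E//= addrAC subrr add0r.
rewrite mulmxA -map_mxM mulmxE -exprzDr ?CS_unit// addNr expr0z.
by rewrite map_mx1 mul1mx.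
Qed.

(** The exponent [k + 1] is the one that bottom facets of the next copies use, which is why the
    copies stack. *)
Lemma weight_top c k v x : simplex x -> top x ->
  weight c k v x =1 kuhn (k + 1) (position c k v x).
Proof.
move=> sx bx z; rewrite weight_place weight0_top//.
rewrite -kuhn_arg ?(proj2 sx)// -CS_invE mulmxA -map_mxM mulmxE.
by rewrite -exprzDr ?CS_unit// /kuhn opprD [- k - 1]addrC.
Qed.

End Hat.

(** * Gluings as moves of lattice pentachora *)

Section Gluing.
Context (R : realType).
Implicit Types (x y : 'rV[R]_5) (k : int) (z v : 'cV[int]_3) (c : bool).

Lemma vert_shift c c' k v (d : int) w i j :
  CS_matrix ^ d *m vtx c' j + w = vtx c i ->
  vert c' (k + d) (CS_matrix ^ k *m w + v) j = vert c k v i.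
Proof.
move=> E; rewrite /vert /place exprzDr ?CS_unit// -mulmxE -mulmxA addrA.
by rewrite -mulmxDr E.
Qed.

(* An entry [((c, f), (c', f'), (d, w))] says that [z |-> A^d z + w] carries the
   vertices [f'] of the lattice pentachoron [c'] to the vertices [f] of [c]. *)
Definition moves : seq ((bool * seq nat) * (bool * seq nat) *
                        (nat * 'cV[int]_3)) :=
  [:: ((true, [:: 1; 2; 3; 4]), (true, [:: 0; 1; 2; 4]), (1, col3 1%R (-1)%R 0%R));
      ((true, [:: 0; 1; 2; 3]), (false, [:: 0; 1; 3; 4]), (2, 0%R));
      ((true, [:: 0; 2; 3; 4]), (false, [:: 0; 1; 2; 4]), (0, 0%R));
      ((false, [:: 1; 2; 3; 4]), (true, [:: 0; 1; 3; 4]), (2, col3 1%R 0%R (-1)%R));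
      ((false, [:: 0; 1; 2; 3]), (false, [:: 0; 2; 3; 4]), (1, 0%R))]%N.

Lemma moves_vert e k v i : e \in moves -> (i < 4)%N ->
  vert e.1.2.1 (k + e.2.1%:Z) (CS_matrix ^ k *m e.2.2 + v) (nth 0%N e.1.2.2 i) =
  vert e.1.1.1 k v (nth 0%N e.1.1.2 i).
Proof.
move=> em i4; apply: vert_shift; move: em.
have A1 : CS_matrix ^ 1%N = CS_matrix by [].
have A2 z : CS_matrix ^ 2%N *m z = CS_matrix *m (CS_matrix *m z).
  by rewrite -exprnP expr2 -mulmxE mulmxA.
rewrite !inE; do 4?case/orP; move=> /eqP -> /=;
  case: i i4 => [|[|[|[|//]]]] _ /=; rewrite ?A2 ?A1 ?expr0z ?mul1mx ?addr0;
  rewrite /vtx /= ?CS_mulzE; apply: col3P; rewrite !mxE ?inordK//=.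
Qed.

Lemma moves_size e : e \in moves ->
  [/\ size e.1.1.2 = 4%N, size e.1.2.2 = 4%N,
      all (fun i => i < 5)%N e.1.1.2 & all (fun i => i < 5)%N e.1.2.2].
Proof. by rewrite !inE; do 4?case/orP; move=> /eqP ->. Qed.

Lemma weight_tetra c k v f (t : 'rV[R]_4) z : size f = 4%N ->
  all (fun i => i < 5)%N f ->
  weight c k v (tetra_point f t) z =
  \sum_(i < 4) t 0 i * (vert c k v (nth 0%N f i) == z)%:R.
Proof.
move=> f4 /allP f5; rewrite /weight /tetra_point.
under eq_bigr do rewrite summxE mulr_suml.
rewrite exchange_big /=; apply: eq_bigr => i _.
have fi : (nth 0 f i < 5)%N by apply: f5; rewrite mem_nth// f4.
rewrite (bigD1 (inord (nth 0%N f i)))//= [X in _ + X]big1 ?addr0; last first.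
  by move=> j /negPf ji; rewrite !mxE ji mulr0 mul0r.
by rewrite !mxE !eqxx mulr1 inordK.
Qed.

Lemma weight_move e k v (t : 'rV[R]_4) : e \in moves ->
  weight e.1.2.1 (k + e.2.1%:Z) (CS_matrix ^ k *m e.2.2 + v)
    (tetra_point e.1.2.2 t) =1
  weight e.1.1.1 k v (tetra_point e.1.1.2 t).
Proof.
move=> em z; have [s1 s2 f1 f2] := moves_size em.
rewrite !weight_tetra//; apply: eq_bigr => i _.
by rewrite moves_vert.
Qed.

(** The list [moves] contains the same five gluings, oriented with nonnegative exponents; three of
    them run opposite to [gluings]. *)
Lemma gluing_moves e : e \in gluings ->
  exists2 m, m \in moves & (e = (m.1.1, m.1.2) \/ e = (m.1.2, m.1.1)).
Proof.
pose mv n := nth ((true, [::]), (true, [::]), (0%N, 0%R)) moves n.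
rewrite !inE; do 4?case/orP; move=> /eqP ->.
- by exists (mv 0%N); [exact: mem_nth|right].
- by exists (mv 1%N); [exact: mem_nth|right].
- by exists (mv 2%N); [exact: mem_nth|right].
- by exists (mv 3%N); [exact: mem_nth|left].
- by exists (mv 4%N); [exact: mem_nth|left].
Qed.

Lemma weight_gluing e (t : 'rV[R]_4) k v : e \in gluings ->
  exists k' v', weight e.1.1 k v (tetra_point e.1.2 t) =1
                weight e.2.1 k' v' (tetra_point e.2.2 t).
Proof.
move=> /gluing_moves[m mm [->|->]].
  by exists (k + m.2.1%:Z), (CS_matrix ^ k *m m.2.2 + v) => z; rewrite weight_move.
(* Against the move, [k'] and [v'] solve [k' + d = k] and [A^k' w + v' = v]. *)
exists (k - m.2.1%:Z), (v - CS_matrix ^ (k - m.2.1%:Z) *m m.2.2) => z /=.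
by rewrite -(weight_move _ _ _ mm) subrK subrKC.
Qed.

Lemma tetra_pointE f (t : 'rV[R]_4) i : size f = 4%N -> uniq f ->
  all (fun i => i < 5)%N f -> (i < 5)%N ->
  cf (tetra_point f t) i = if i \in f then t 0 (inord (index i f)) else 0.
Proof.
move=> f4 uf /allP f5 i5.
rewrite /cf /tetra_point summxE.
have E (j : 'I_4) : (t 0 j *: delta_mx 0 (inord (nth 0%N f j)) : 'rV[R]_5)
    0 (inord i) = t 0 j * (nth 0%N f j == i)%:R.
  rewrite !mxE eqxx /= -val_eqE /= !inordK// 1?eq_sym//.
  by apply: f5; rewrite mem_nth// f4.
under eq_bigr do rewrite E.
case: ifPn => fi; last first.
  rewrite big1// => j _; case: eqP => [ji|]; last by rewrite mulr0.
  by case/negP: fi; rewrite -ji mem_nth// f4.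
have i4 : (index i f < 4)%N by rewrite -f4 index_mem.
rewrite (bigD1 (inord (index i f)))//= big1 ?addr0.
  by rewrite inordK// nth_index// eqxx mulr1.
move=> j /eqP ji; case: eqP => [fj|]; last by rewrite mulr0.
by case: ji; apply: val_inj; rewrite /= inordK// -fj index_uniq// f4.
Qed.

Definition face (f : seq nat) x : 'rV[R]_4 := \row_i cf x (nth 0%N f i).

Lemma face_tetra f x : size f = 4%N -> uniq f ->
  all (fun i => i < 5)%N f -> (forall i, (i < 5)%N -> i \notin f -> cf x i = 0) ->
  x = tetra_point f (face f x).
Proof.
move=> f4 uf f5 x0; apply: row5_ext => i i5; rewrite tetra_pointE//.
case: ifPn => [fi|/x0->//]; rewrite mxE inordK ?nth_index//.
by rewrite -f4 index_mem.
Qed.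

Lemma sum_tetra f (t : 'rV[R]_4) : \sum_j tetra_point f t 0 j = \sum_i t 0 i.
Proof.
rewrite /tetra_point; under eq_bigr do rewrite summxE.
rewrite exchange_big /=; apply: eq_bigr => i _.
rewrite (bigD1 (inord (nth 0%N f i)))//= big1 ?addr0 ?mxE ?eqxx ?mulr1//.
by move=> j /negPf ji; rewrite !mxE ji mulr0.
Qed.

Lemma simplex_tetra f (t : 'rV[R]_4) :
  (forall i, 0 <= t 0 i) -> \sum_i t 0 i = 1 -> simplex (tetra_point f t).
Proof.
move=> t0 t1; split; last by rewrite sum_tetra.
by move=> i; rewrite /tetra_point summxE sumr_ge0// => j _; rewrite !mxE mulr_ge0.
Qed.

Lemma simplex_face f f' x : size f = 4%N -> uniq f ->
  all (fun i => i < 5)%N f -> (forall i, (i < 5)%N -> i \notin f -> cf x i = 0) ->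
  simplex x -> simplex (tetra_point f' (face f x)).
Proof.
move=> f4 uf f5 x0 sx; apply: simplex_tetra.
  by move=> i; rewrite mxE; exact: simplex_cf.
by rewrite -(sum_tetra f) -face_tetra//; case: sx.
Qed.

Lemma move_up k v x e : e \in moves -> simplex x ->
  (forall i, (i < 5)%N -> i \notin e.1.1.2 -> cf x i = 0) ->
  exists v' x', [/\ simplex x',
    forall i, (i < 5)%N -> i \notin e.1.2.2 -> cf x' i = 0
    & weight e.1.2.1 (k + e.2.1%:Z) v' x' =1 weight e.1.1.1 k v x].
Proof.
move=> em sx x0; have [s1 s2 f1 f2] := moves_size em.
have [u1 u2] : uniq e.1.1.2 /\ uniq e.1.2.2.
  by move: em; rewrite !inE; do 4?case/orP; move=> /eqP ->.
exists (CS_matrix ^ k *m e.2.2 + v), (tetra_point e.1.2.2 (face e.1.1.2 x)).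
split; first exact: simplex_face.
  by move=> i i5 /negPf ie; rewrite tetra_pointE// ie.
by move=> z; rewrite weight_move// -face_tetra.
Qed.

(** The move of exponent 0: the red facet opposite vertex 3 and the green facet opposite vertex 1
    are both spanned by the common parallelogram. *)
Lemma move_flat k v x : simplex x -> cf x 3 = 0 ->
  exists2 x', simplex x' & weight true k v x' =1 weight false k v x.
Proof.
move=> sx x3; exists (tetra_point [:: 0; 2; 3; 4]%N (face [:: 0; 1; 2; 4]%N x)).
  by apply: simplex_face => //; case=> [|[|[|[|[|//]]]]].
have em : nth ((true, [::]), (true, [::]), (0%N, 0%R)) moves 2 \in moves.
  exact: mem_nth.
move=> z; have := weight_move k v (face [:: 0; 1; 2; 4]%N x) em z => /= <-.
by rewrite -face_tetra ?addr0 ?mulmx0 ?add0r//; case=> [|[|[|[|[|//]]]]].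
Qed.

(** Each of the four top facets is the source of a move of exponent 1 or 2 whose target is a bottom
    facet. *)
Lemma top_bottom c k v x : simplex x -> top x ->
  exists c' k' v' x', [/\ simplex x', bottom c' x', k' = k + 1 \/ k' = k + 2
    & weight c' k' v' x' =1 weight c k v x].
Proof.
move=> sx tx; pose mv n := nth ((true, [::]), (true, [::]), (0%N, 0)) moves n.
have up n : (n < 5)%N -> c = (mv n).1.1.1 ->
    (forall i, (i < 5)%N -> i \notin (mv n).1.1.2 -> cf x i = 0) ->
    (mv n).2.1 = 1%N \/ (mv n).2.1 = 2%N ->
    (lo (mv n).1.2.1 \notin (mv n).1.2.2) ||
      ((lo (mv n).1.2.1).+1 \notin (mv n).1.2.2) ->
  exists c' k' v' x', [/\ simplex x', bottom c' x', k' = k + 1 \/ k' = k + 2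
    & weight c' k' v' x' =1 weight c k v x].
  move=> n5 -> x0 d b; have em : mv n \in moves by exact: mem_nth.
  have [v' [x' [sx' x'0 w]]] := move_up k v em sx x0.
  exists (mv n).1.2.1, (k + (mv n).2.1%:Z), v', x'; split => //.
    by apply/orP; case/orP: b => /x'0 b; [left|right]; apply/eqP/b;
      case: (mv n).1.2.1.
  by case: d => ->; [left|right].
case: c up; case/orP: tx => /eqP x0 up.
- by apply: (up 0%N) => //; [case=> [|[|[|[|[|//]]]]]|left].
- by apply: (up 1%N) => //; [case=> [|[|[|[|[|//]]]]]|right].
- by apply: (up 3%N) => //; [case=> [|[|[|[|[|//]]]]]|right].
- by apply: (up 4%N) => //; [case=> [|[|[|[|[|//]]]]]|left].
Qed.

End Gluing.

(** * Injectivity *)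

Section Injectivity.
Context (R : realType).
Implicit Types (x y : 'rV[R]_5) (k : int) (z v : 'cV[int]_3) (c : bool).

Definition lattice (p : 'cV[R]_3) := exists z : 'cV[int]_3, p = map_mx intr z.

Lemma int01 (t : R) (m : int) : 0 <= t <= 1 -> t = m%:~R -> t = 0 \/ t = 1.
Proof.
move=> t01 tm; case: (int_near_01 R m) => [h|h|h|h]; try lra.
  by left; rewrite tm h.
by right; rewrite tm h.
Qed.

Lemma cf_delta i j : (i < 5)%N -> (j < 5)%N ->
  cf (delta_mx 0 (inord i) : 'rV[R]_5) j = (j == i)%:R.
Proof. by move=> i5 j5; rewrite /cf mxE eqxx -val_eqE /= !inordK. Qed.

(** Integrality forces coordinate 1 to be 0 or 1, then, if it is 0, the sum of coordinates 2 and 4,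
    and finally coordinate 3 or 2. *)
Lemma green_vertex x z : simplex x -> position true 0 0 x = map_mx intr z ->
  exists2 i, (i < 5)%N & x = delta_mx 0 (inord i).
Proof.
move=> sx; have x0 := simplex_cf sx; have := cf_sum x; rewrite (proj2 sx).
rewrite position0E => /esym x1 E.
have E0 : cf x 1 + cf x 2 + cf x 4 = (z (inord 0) 0)%:~R.
  by move/(congr1 (fun m : 'cV__ => m (inord 0) 0)): E; rewrite !mxE inordK.
have E1 : - cf x 1 = (z (inord 1) 0)%:~R.
  by move/(congr1 (fun m : 'cV__ => m (inord 1) 0)): E; rewrite !mxE inordK.
have E2 : cf x 3 - cf x 2 = (z (inord 2) 0)%:~R.
  by move/(congr1 (fun m : 'cV__ => m (inord 2) 0)): E; rewrite !mxE inordK.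
have := (x0 0%N, x0 1%N, x0 2%N, x0 3%N, x0 4%N) => -[[[[p0 p1] p2] p3] p4].
have vertex i : (i < 5)%N -> cf x i = 1 ->
    exists2 i, (i < 5)%N & x = delta_mx 0 (inord i).
  move=> i5 xi; exists i => //; apply: row5_ext => j j5; rewrite cf_delta//.
  by case: i i5 xi => [|[|[|[|[|//]]]]] _ xi; case: j j5 => [|[|[|[|[|//]]]]] _ /=; lra.
have [|||h1] := @int01 (cf x 1) (- z (inord 1) 0).
- by lra.
- by rewrite rmorphN /=; lra.
- move=> h1; have [|||h2] := @int01 (cf x 2 + cf x 4) (z (inord 0) 0).
  + by lra.
  + by lra.
  + move=> h2; have [|||h3] := @int01 (cf x 3) (z (inord 2) 0).
    * by lra.
    * by lra.
    * by move=> h3; apply: (vertex 0%N) => //; lra.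
    * exact: (vertex 3%N).
  + have [|||h3] := @int01 (cf x 2) (- z (inord 2) 0).
    * by lra.
    * by rewrite rmorphN /=; lra.
    * by move=> h3; apply: (vertex 4%N) => //; lra.
    * exact: (vertex 2%N).
- exact: (vertex 1%N).
Qed.

Lemma lattice_position c k v x : simplex x -> lattice (position c k v x) ->
  exists i, x = delta_mx 0 i.
Proof.
move=> sx [z]; rewrite positionE (proj2 sx) scale1r => E.
have {}E : position c 0 0 x = map_mx intr (CS_matrix ^ (- k) *m (z - v)).
  rewrite map_mxM map_mxB -E addrK mulmxA -map_mxM mulmxE -exprzDr ?CS_unit//.
  by rewrite addNr expr0z map_mx1 mul1mx.
case: c E => E; first by have [i _ ->] := green_vertex sx E; exists (inord i).
move: E; rewrite position_reverse ?(proj2 sx)//.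
move=> /(congr1 (fun p => map_mx intr (col3 1 0 0) - p)).
rewrite opprB addrC subrK -map_mxB => /(green_vertex (simplex_reverse sx))[i i5 E].
exists (inord (4 - i)); rewrite -[x]reverseK E; apply: row5_ext => j j5.
rewrite reverseE// !cf_delta//; last 2 first.
- by rewrite ltnS leq_subr.
- by rewrite ltnS leq_subr.
by congr (_%:R); congr nat_of_bool; lia.
Qed.

Lemma position_vertex c k v i :
  position c k v (delta_mx 0 i : 'rV[R]_5) = map_mx intr (vert c k v i).
Proof.
rewrite /position (bigD1 i)//= !mxE !eqxx scale1r big1 ?addr0// => j /negPf ji.
by rewrite !mxE ji scale0r.
Qed.

Lemma den_gt0_nonlattice c k v x : simplex x ->
  ~ lattice (position c k v x) -> 0 < den x.
Proof.
move=> sx nl; apply: den_gt0 => // i xi; apply: nl.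
by exists (vert c k v i); rewrite xi position_vertex.
Qed.

Lemma depth_ge0 c x : simplex x -> 0 <= depth c x.
Proof. by move=> sx; rewrite le_min !simplex_cf. Qed.

Lemma room_ge0 x : simplex x -> 0 <= room x.
Proof. by move=> sx; rewrite le_min !simplex_cf. Qed.

Lemma bottomE c x : simplex x -> bottom c x = (depth c x == 0).
Proof.
move=> sx; have x0 := simplex_cf sx; rewrite /bottom /depth.
have := (x0 (lo c), x0 (lo c).+1) => -[a b].
case: (leP (cf x (lo c)) (cf x (lo c).+1)) => h;
  apply/orP/eqP => [[]/eqP|]; lra.
Qed.

Lemma sink c x : simplex x ->
  simplex (flow c (- depth c x) x) /\ bottom c (flow c (- depth c x) x).
Proof.
move=> sx; split.
  by apply: simplex_flow => //; have := depth_ge0 c sx; have := room_ge0 sx; lra.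
rewrite /bottom !flowE !cf_direction; try by case: c.
rewrite /depth; case: (leP (cf x (lo c)) (cf x (lo c).+1)) => h; apply/orP.
  by left; apply/eqP; case: (c) => /=; lra.
by right; apply/eqP; case: (c) => /=; lra.
Qed.

Lemma rise c x : simplex x ->
  simplex (flow c (room x) x) /\ top (flow c (room x) x).
Proof.
move=> sx; split.
  by apply: simplex_flow => //; have := depth_ge0 c sx; have := room_ge0 sx; lra.
rewrite /top !flowE !cf_direction//.
rewrite /room; case: (leP (cf x 0) (cf x 4)) => h; apply/orP.
  by left; apply/eqP; case: (c) => /=; lra.
by right; apply/eqP; case: (c) => /=; lra.
Qed.

(** Flowing down by [depth] keeps the position and ends on a bottom facet, where weights are Kuhn
    coordinates; [kuhn_rise] does the same upwards. *)
Lemma kuhn_sink c k v x z : simplex x ->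
  kuhn k (position c k v x) z = weight c k v x z - depth c x * shift R k v z.
Proof.
move=> sx; have [s b] := sink c sx.
by rewrite -(position_flow c k v (- depth c x)) -weight_bottom// weight_flow mulNr.
Qed.

Lemma kuhn_rise c k v x z : simplex x ->
  kuhn (k + 1) (position c k v x) z = weight c k v x z + room x * shift R k v z.
Proof.
move=> sx; have [s b] := rise c sx.
by rewrite -(position_flow c k v (room x)) -weight_top// weight_flow.
Qed.

Lemma shift_vert k v z : shift R k v z =
  (vert true k v 3 == z)%:R + (vert true k v 2 == z)%:R
  - (vert true k v 0 == z)%:R - (vert true k v 4 == z)%:R.
Proof. by []. Qed.

Lemma vert_eq c k v i j : (i < 5)%N -> (j < 5)%N ->
  (vert c k v i == vert c k v j) = (i == j).
Proof.
move=> i5 j5; case: (ltngtP i j) => [ij|ij|->]; last exact: eqxx.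
  exact/negbTE/(vert_inj R).
by rewrite eq_sym; exact/negbTE/(vert_inj R).
Qed.

Lemma shift_lt0 k v z : shift R k v z < 0 ->
  z = vert true k v 0 \/ z = vert true k v 4.
Proof.
rewrite shift_vert; case: eqP => [<-|_]; first by rewrite !vert_eq//= => ?; exfalso; lra.
case: eqP => [<-|_]; first by rewrite !vert_eq//= => ?; exfalso; lra.
case: eqP => [<-|_]; first by left.
by case: eqP => [<-|_] ?; [right|exfalso; lra].
Qed.

Lemma shift_start k v : shift R k v (vert true k v 0) = -1.
Proof. by rewrite shift_vert !vert_eq//=; lra. Qed.

(** A [shift] is negative only at two opposite corners of its parallelogram, so the first corner of
    each is one of these two corners of the other. If [v] and [v'] differed, each would be the other
    plus [A^k e_1], on which [ell] is positive. *)
Lemma shift_eq k v v' (a b : R) : 0 <= a -> 0 <= b ->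
  (forall z, a * shift R k v z = b * shift R k v' z) ->
  (a = 0 /\ b = 0) \/ [/\ v = v', a = b & 0 < a].
Proof.
move=> a0 b0 E; have := E (vert true k v 0); rewrite shift_start.
have := E (vert true k v' 0); rewrite shift_start.
have [->|an0] := eqVneq a 0; first by left; split => //; lra.
have [->|bn0] := eqVneq b 0; first by left; split => //; lra.
have {an0}a0 : 0 < a by rewrite lt_def an0.
have {bn0}b0 : 0 < b by rewrite lt_def bn0.
move=> E1 E2; right.
have n2 : shift R k v' (vert true k v 0) < 0.
  by rewrite -(pmulr_rlt0 _ b0) -E2; lra.
have n1 : shift R k v (vert true k v' 0) < 0.
  by rewrite -(pmulr_rlt0 _ a0) E1; lra.
have vv' : v = v'.
  have V w : vert true k w 0 = w by rewrite /vert /place mulmx0 add0r.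
  case/shift_lt0: n2; rewrite !V// => n2.
  case/shift_lt0: n1; rewrite !V// => n1.
  have := congr1 (ell R) n1; have := congr1 (ell R) n2.
  have l0 := lam_exp_gt0 R k.
  have e1 : ell R (vtx true 4) = 1.
    by rewrite /ell /= !mxE !inordK//= !mulr0z !mul0r !addr0.
  by rewrite !ell_place e1 => ? ?; exfalso; lra.
by split=> //; move: E1; rewrite vv' shift_start; lra.
Qed.

Lemma flow_level c k v x y r : simplex x -> simplex y ->
  ~ lattice (position c k v x) -> 0 < r ->
  (forall z, weight c k v y z = weight c k v x z + r * shift R k v z) ->
  level c k x < level c k y.
Proof.
move=> sx sy nl r0 E; have yE : y = flow c r x.
  by apply: (@flow_inj_weight _ c k v) => z; rewrite weight_flow E.
have y0 := simplex_cf sy 0; have y4 := simplex_cf sy 4.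
rewrite yE; apply: level_flow => //.
- move: y0 y4; rewrite yE !flowE !cf_direction// le_min.
  by case: (c) => /= ? ?; apply/andP; split; lra.
- exact: den_gt0_nonlattice nl.
- by apply: (@den_gt0_nonlattice c k v); rewrite -?yE// yE position_flow.
Qed.

(** Both fibres join the same Kuhn coordinates below to the same ones above. By [shift_eq] they are
    either both single points or parallel and equally long with equal translations, and then [depth]
    measures the place along them. *)
Lemma same_level c c' k v v' x x' : simplex x -> simplex x' ->
  ~ lattice (position c k v x) ->
  position c k v x = position c' k v' x' ->
  (depth c x = depth c' x' -> weight c k v x =1 weight c' k v' x') /\
  (depth c x < depth c' x' -> level c k x < level c' k x').
Proof.
move=> sx sx' nl pE.
have lowE z : weight c k v x z - depth c x * shift R k v z =
    weight c' k v' x' z - depth c' x' * shift R k v' z.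
  by rewrite -!kuhn_sink// pE.
have upE z : weight c k v x z + room x * shift R k v z =
    weight c' k v' x' z + room x' * shift R k v' z.
  by rewrite -!kuhn_rise// pE.
have d0 := depth_ge0 c sx; have d0' := depth_ge0 c' sx'.
have r0 := room_ge0 sx; have r0' := room_ge0 sx'.
have [|||[h h']|[vv' h h0]] := @shift_eq k v v' (depth c x + room x)
  (depth c' x' + room x').
- exact: addr_ge0.
- exact: addr_ge0.
- by move=> z; have := lowE z; have := upE z; lra.
- have [D D'] : depth c x = 0 /\ depth c' x' = 0 by lra.
  rewrite D D' ltxx; split => // _ z.
  by have := lowE z; rewrite D D' !mul0r !subr0.
subst v'; split; first by move=> D z; have := lowE z; rewrite D; lra.
rewrite -subr_gt0 => D.
have E z : weight c' k v x' z =
    weight c k v x z + (depth c' x' - depth c x) * shift R k v z.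
  by have := lowE z; lra.
(* The apex of the red pyramid is not a green vertex, and [shift] vanishes there. For points of
   different colours, comparing weights at it puts the red point on the shared facet, where
   [move_flat] recolours it. *)
pose w := vert false k v 3.
have trueNw i : (i < 5)%N -> (vert true k v i == w) = false.
  move=> i5; apply/negbTE/negP => /eqP/place_inj/eqP.
  by rewrite col3_eq; case: i i5 => [|[|[|[|[|//]]]]] _;
    rewrite /= !mxE !inordK.
have falsew y : weight false k v y w = cf y 3.
  rewrite /weight (sum5n y (fun a i => a * (vert false k v i == w)%:R)).
  by rewrite !vert_eq//= !mulr0 !add0r addr0 mulr1.
have truew y : weight true k v y w = 0.
  rewrite /weight big1// => i _; by rewrite trueNw// mulr0.
have shiftw : shift R k v w = 0 by rewrite shift_vert !trueNw// !subr0 addr0.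
have nl' : ~ lattice (position c' k v x') by rewrite -pE.
have dx := den_gt0_nonlattice sx nl; have dx' := den_gt0_nonlattice sx' nl'.
case: c c' E nl nl' {pE lowE upE h h0 d0 d0'} D => -[] E nl nl' D.
- exact: flow_level E.
- have x3 : cf x' 3 = 0 by rewrite -falsew E shiftw truew mulr0 addr0.
  have [y sy yE] := move_flat k v sx' x3.
  rewrite -(weight_level _ yE) ?(weight_den yE) ?gt_eqF//.
  by apply: (@flow_level _ _ v _ _ _ sx sy nl D) => z; rewrite yE E.
- have x3 : cf x 3 = 0.
    by have := E w; rewrite falsew truew shiftw mulr0 addr0.
  have [y sy yE] := move_flat k v sx x3.
  rewrite -(weight_level _ yE) ?(weight_den yE) ?gt_eqF//.
  apply: (@flow_level _ _ v _ _ _ sy sx' _ D) => [|z]; last by rewrite yE E.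
  by rewrite (weight_position yE).
- exact: flow_level E.
Qed.

(** Induction on a bound for [k' - k]. The point rises to its top facet, which cannot lower the
    level, and passes to a bottom facet one or two copies up; equal levels force each rise to be
    trivial. *)
Lemma cross_level (n : nat) c c' k k' v v' x x' : simplex x -> simplex x' ->
  ~ lattice (position c k v x) ->
  position c k v x = position c' k' v' x' ->
  k < k' -> k' - k <= n%:Z ->
  level c k x <= level c' k' x' /\
  (level c k x = level c' k' x' -> weight c k v x =1 weight c' k' v' x').
Proof.
elim: n c k v x => [|n IH] c k v x sx sx' nl pE kk' kn; first by lia.
have r0 := room_ge0 sx; have [sy ty] := rise c sx.
set y := flow c (room x) x in sy ty.
have yp : position c k v y = position c k v x by rewrite position_flow.
have nly : ~ lattice (position c k v y) by rewrite yp.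
have dy := den_gt0_nonlattice sy nly.
have [le eq] : level c k x <= level c k y /\ (level c k x = level c k y -> x = y).
  have [r00|rn0] := eqVneq (room x) 0; first by rewrite /y r00 flow0.
  have lt : level c k x < level c k y.
    apply: level_flow => //; first by rewrite lt_def rn0.
    exact: den_gt0_nonlattice nl.
  by split; [exact: ltW|move=> E; rewrite E ltxx in lt].
have [c2 [k2 [v2 [y2 [sy2 by2 k2E w2]]]]] := top_bottom c k v sy ty.
have p2 : position c2 k2 v2 y2 = position c' k' v' x'.
  by rewrite (weight_position w2) yp.
have nl2 : ~ lattice (position c2 k2 v2 y2) by rewrite p2 -pE.
have d2 := den_gt0_nonlattice sy2 nl2.
have l2 : level c2 k2 y2 = level c k y.
  by apply: weight_level w2; rewrite gt_eqF.
have finish : level c k y <= level c' k' x' /\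
    (level c k y = level c' k' x' -> weight c k v y =1 weight c' k' v' x') ->
  level c k x <= level c' k' x' /\
    (level c k x = level c' k' x' -> weight c k v x =1 weight c' k' v' x').
  move=> [le2 eq2]; split; first exact: le_trans le2.
  move=> E; have E1 : level c k x = level c k y.
    by apply/le_anti; rewrite le E.
  by rewrite (eq E1); apply: eq2; rewrite -E1.
apply: finish; have [lt|gt|ke] := ltgtP k2 k'.
- have [|h1 h2] := IH c2 k2 v2 y2 sy2 sx' nl2 p2 lt; first by lia.
  by rewrite -l2; split=> // /h2 h z; rewrite -w2.
(* A move of exponent 2 has jumped over [k']. The point [y] then lies in both Kuhn triangulations
   bounding the copies [k'], so the fibre through [x'] is a single point with the weights of [y]. *)
- have k2e : k2 = k' + 1 by lia.
  have k1e : k' = k + 1 by lia.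
  have up z : kuhn (k' + 1) (position c' k' v' x') z = weight c k v y z.
    by rewrite -p2 -k2e -weight_bottom.
  have lw z : kuhn k' (position c' k' v' x') z = weight c k v y z.
    by rewrite -p2 (weight_position w2) k1e -weight_top.
  have d0 := depth_ge0 c' sx'; have r0' := room_ge0 sx'.
  have s1 : shift R k' v' (vert true k' v' 0) = -1 := shift_start k' v'.
  have D : depth c' x' = 0.
    have := lw (vert true k' v' 0); rewrite -up kuhn_rise// kuhn_sink// s1; lra.
  have E : weight c k v y =1 weight c' k' v' x'.
    by move=> z; rewrite -lw kuhn_sink// D mul0r subr0.
  by rewrite (weight_level _ E) ?gt_eqF.
(* The bottom point [y2] has depth 0, so it cannot lie above [x']. *)
- subst k2; have [E L] := same_level sy2 sx' nl2 p2.
  have b0 : depth c2 y2 = 0 by apply/eqP; rewrite -bottomE.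
  rewrite b0 in E L; rewrite -l2.
  have := depth_ge0 c' sx'; rewrite le_eqVlt => /predU1P[D|D].
    have {}E := E D; rewrite (weight_level _ E) ?gt_eqF//.
    by split=> // _ z; rewrite -w2.
  have lt := L D; split; first exact: ltW.
  by move=> e; rewrite e ltxx in lt.
Qed.

Lemma level_inj c c' k k' v v' x x' : simplex x -> simplex x' ->
  ~ lattice (position c k v x) ->
  position c k v x = position c' k' v' x' ->
  level c k x = level c' k' x' -> weight c k v x =1 weight c' k' v' x'.
Proof.
move=> sx sx' nl pE lE; have nl' : ~ lattice (position c' k' v' x').
  by rewrite -pE.
have [lt|lt|ke] := ltgtP k k'.
- have [|_ h] := @cross_level `|k' - k|%N _ _ _ _ _ _ _ _ sx sx' nl pE lt.
    by lia.
  exact: h.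
- have [|_ h] := @cross_level `|k - k'|%N _ _ _ _ _ _ _ _ sx' sx nl' (esym pE) lt.
    by lia.
  by move=> z; rewrite h.
subst k'; have [E L] := same_level sx sx' nl pE.
have [_ L'] := same_level sx' sx nl' (esym pE).
apply: E; case: (ltgtP (depth c x) (depth c' x')) => // D.
  by have := L D; rewrite lE ltxx.
by have := L' D; rewrite lE ltxx.
Qed.

End Injectivity.

(** * Surjectivity *)

Section Surjectivity.
Context (R : realType).
Implicit Types (x y : 'rV[R]_5) (k : int) (z v : 'cV[int]_3) (c : bool).

Lemma position_place c k v x K w : \sum_i x 0 i = 1 ->
  position c (K + k) (place K w v) x =
  map_mx intr (CS_matrix ^ K) *m position c k v x + map_mx intr w.
Proof.
move=> x1; rewrite (positionE c (K + k)) (positionE c k v) x1 !scale1r.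
rewrite mulmxDr mulmxA -map_mxM mulmxE.
by rewrite -exprzDr ?CS_unit// /place map_mxD map_mxM addrA.
Qed.

(** The order of the fractional parts selects one of the six Kuhn simplices of a unit cube. Four are
    bottom facets of copies with [k = 0], the other two of copies with [k = 1]. *)
Lemma kuhn_cover (q : 'cV[R]_3) : exists c k v x,
  [/\ simplex x, position c k v x = q & k = 0 \/ k = 1].
Proof.
pose y0 := q (inord 0) 0; pose y1 := q (inord 0) 0 + q (inord 1) 0.
pose y2 := - q (inord 2) 0.
pose n0 := Num.floor y0; pose n1 := Num.floor y1; pose n2 := Num.floor y2.
(* The lattice point whose coordinates, after the change made in [hat], are [n0 + a], [n1 + b],
   [n2 + d]. *)
pose v (a b d : int) := col3 (n0 + a) (n1 + b - n0 - a) (- n2 - d).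
have [a0 a1] : 0 <= y0 - n0%:~R /\ y0 - n0%:~R <= 1.
  by have := ge_floor y0; have := floorD1_gt y0; rewrite rmorphD /=; lra.
have [b0 b1] : 0 <= y1 - n1%:~R /\ y1 - n1%:~R <= 1.
  by have := ge_floor y1; have := floorD1_gt y1; rewrite rmorphD /=; lra.
have [d0 d1] : 0 <= y2 - n2%:~R /\ y2 - n2%:~R <= 1.
  by have := ge_floor y2; have := floorD1_gt y2; rewrite rmorphD /=; lra.
set f0 := y0 - _ in a0 a1; set f1 := y1 - _ in b0 b1; set f2 := y2 - _ in d0 d1.
have q0 : q (inord 0) 0 = n0%:~R + f0 by rewrite /f0 subrKC.
have q1 : q (inord 1) 0 = n1%:~R + f1 - n0%:~R - f0.
  by rewrite /f0 /f1 !subrKC /y1 /y0; ring.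
have q2 : q (inord 2) 0 = - n2%:~R - f2 by rewrite /f2 /y2; ring.
have main c (k : nat) a b d (e0 e1 e2 e3 e4 : R) :
    [&& 0 <= e0, 0 <= e1, 0 <= e2, 0 <= e3 & 0 <= e4] ->
    e0 + e1 + e2 + e3 + e4 = 1 -> k = 0%N \/ k = 1%N ->
    position c k%:Z (v a b d) (row5 e0 e1 e2 e3 e4) = q ->
  exists c k v x, [/\ simplex x, position c k v x = q & k = 0 \/ k = 1].
  move=> /and5P[p0 p1 p2 p3 p4] es k01 E.
  exists c, k%:Z, (v a b d), (row5 e0 e1 e2 e3 e4); split=> //.
    apply: simplexP; last by rewrite !row5E.
    by move=> i i5; rewrite row5E//; case: i i5 => [|[|[|[|[|//]]]]].
  by case: k01 => ->; [left|right].
have pos c (k : nat) a b d (e0 e1 e2 e3 e4 : R) :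
    e0 + e1 + e2 + e3 + e4 = 1 -> k = 0%N \/ k = 1%N ->
    (let p := if c then (e1 + e2 + e4, - e1, e3 - e2) else (e1 + e4, e3, e2 - e1) in
     let p' := if k is 0%N then p else (p.2, p.1.1, p.1.2 - p.2) in
     p' = (f0 - a%:~R, f1 - b%:~R - (f0 - a%:~R), - f2 + d%:~R)) ->
    position c k%:Z (v a b d) (row5 e0 e1 e2 e3 e4) = q.
  move=> es k01 E; rewrite positionE cf_sum !row5E//= es scale1r position0E !row5E//=.
  case: k01 E => -> /=.
    rewrite expr0z map_mx1 mul1mx; case: c => -[E0 E1 E2];
    by apply: col3P; rewrite !mxE !inordK//= ?q0 ?q1 ?q2
       ?rmorphB ?rmorphN ?rmorphD /= ?rmorphB ?rmorphN ?rmorphD /=; lra.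
  rewrite CS_mulE; case: c => -[E0 E1 E2];
    by apply: col3P; rewrite !mxE !inordK//= ?mxE ?inordK//= ?q0 ?q1 ?q2
       ?rmorphB ?rmorphN ?rmorphD /= ?rmorphB ?rmorphN ?rmorphD /=; lra.
clearbody f0 f1 f2.
case: (lerP f1 f0) => h01; case: (lerP f2 f1) => h12; case: (lerP f2 f0) => h02;
  try (exfalso; lra).
- apply: (main true 0%N 0 0 0 (1 - f0) (f0 - f1) f2 0 (f1 - f2)); [lra|lra|by left|].
  by apply: pos; [ring|left|rewrite /=; congr (_, _, _); ring].
- apply: (main false 1%N 1 0 1 (f2 - f1) (1 - f0) 0 (f0 - f2) f1); [lra|lra|by right|].
  by apply: pos; [ring|right|rewrite /=; congr (_, _, _); ring].
- apply: (main true 0%N 0 0 1 (f2 - f0) (f0 - f1) 0 (1 - f2) f1); [lra|lra|by left|].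
  by apply: pos; [ring|left|rewrite /=; congr (_, _, _); ring].
- apply: (main false 0%N 0 0 0 (1 - f1) f2 0 (f1 - f0) (f0 - f2)); [lra|lra|by left|].
  by apply: pos; [ring|left|rewrite /=; congr (_, _, _); ring].
- apply: (main true 1%N 0 0 0 (1 - f1) (f2 - f0) 0 f0 (f1 - f2)); [lra|lra|by right|].
  by apply: pos; [ring|right|rewrite /=; congr (_, _, _); ring].
- apply: (main false 0%N 0 0 1 (f2 - f1) 0 (1 - f2) (f1 - f0) f0); [lra|lra|by left|].
  by apply: pos; [ring|left|rewrite /=; congr (_, _, _); ring].
Qed.

(** Clearing the denominator, which stays positive along the fibre, turns the equation into a
    polynomial one in the flow parameter. *)
Lemma level_ivt c k v x t : simplex x -> ~ lattice (position c k v x) ->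
  level c k x <= t <= level c k (flow c (room x) x) ->
  exists2 s, 0 <= s <= room x & level c k (flow c s x) = t.
Proof.
move=> sx nl /andP[t0 t1].
have dp s : 0 <= s <= room x -> 0 < den (flow c s x).
  move=> /andP[s0 s1]; apply: (@den_gt0_nonlattice _ c k v).
    by apply: simplex_flow => //; have := depth_ge0 c sx; lra.
  by rewrite position_flow.
have r0 := room_ge0 sx.
pose p : {poly R} := \sum_(e <- ordered_pairs)
  (((height c e.1 e.2)%:R - (t - k%:~R))%:P *
    ((cf x e.1)%:P + (cf (direction R c) e.1)%:P * 'X) *
    ((cf x e.2)%:P + (cf (direction R c) e.2)%:P * 'X)).
have pE s : p.[s] = num c (flow c s x) - (t - k%:~R) * den (flow c s x).
  rewrite horner_sum /num /den mulr_sumr -sumrB; apply: eq_bigr => e _.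
  by rewrite !flowE !(hornerM, hornerD, hornerC, hornerX); ring.
have levelE s : 0 <= s <= room x ->
    num c (flow c s x) = (level c k (flow c s x) - k%:~R) * den (flow c s x).
  by move=> /dp d; rewrite /level addrC addKr divfK// gt_eqF.
have l0 : 0 <= (0 : R) <= room x by rewrite lexx r0.
have l1 : 0 <= room x <= room x by rewrite lexx r0.
have [|s s01 /rootP] := @poly_ivt R p 0 (room x) r0.
  rewrite !pE !levelE// -!mulrBl pmulr_lle0 ?dp// pmulr_lge0 ?dp// flow0.
  by apply/andP; split; lra.
move=> ps; exists s => //; move: ps; rewrite pE levelE// -mulrBl => /eqP.
by rewrite mulf_eq0 (gt_eqF (dp _ s01)) orbF => /eqP; lra.
Qed.

(** Each crossing of a top facet raises [k] by at least 1, and levels are at least [k], so the climb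
    passes [t] within [n] crossings. *)
Lemma reach (n : nat) c k v x t : simplex x ->
  ~ lattice (position c k v x) -> level c k x <= t -> t < k%:~R + n%:R ->
  exists c' k' v' x', [/\ simplex x',
    position c' k' v' x' = position c k v x & level c' k' x' = t].
Proof.
elim: n c k v x => [|n IH] c k v x sx nl lt tn.
  have := level_bounds c k sx (den_gt0_nonlattice sx nl); lra.
have [sy ty] := rise c sx; set y := flow c (room x) x in sy ty.
have yp : position c k v y = position c k v x by rewrite position_flow.
have [ty1|ty1] := lerP t (level c k y).
  have [|s /andP[s0 s1] E] := @level_ivt c k v x t sx nl; first by rewrite lt.
  exists c, k, v, (flow c s x); split=> //; last by rewrite position_flow.
  by apply: simplex_flow => //; have := depth_ge0 c sx; lra.
have [c2 [k2 [v2 [y2 [sy2 _ k2E w2]]]]] := top_bottom c k v sy ty.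
have p2 : position c2 k2 v2 y2 = position c k v x.
  by rewrite (weight_position w2) yp.
have nl2 : ~ lattice (position c2 k2 v2 y2) by rewrite p2.
rewrite -p2; apply: IH => //.
  rewrite (weight_level _ w2) ?ltW// gt_eqF//.
  exact: den_gt0_nonlattice nl2.
by case: k2E => ->; move: tn; rewrite rmorphD /= -natr1; lra.
Qed.

Lemma level_onto (p : 'cV[R]_3) (t : R) : ~ lattice p ->
  exists c k v x, [/\ simplex x, position c k v x = p & level c k x = t].
Proof.
move=> nl.
(* Starting at [K] or [K + 1], levels are at most [K + 8 = floor t - 2], hence below [t]; and
   [t < K + 11] leaves room for the 12 steps used below. *)
have [K KE] : exists K : int, (K%:~R : R) = (Num.floor t)%:~R - 10.
  by exists (Num.floor t - 10); rewrite rmorphB.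
have [c [k [v [x [sx E k01]]]]] := kuhn_cover (map_mx intr (CS_matrix ^ (- K)) *m p).
have pE : position c (K + k) (place K 0 v) x = p.
  rewrite position_place ?(proj2 sx)// E map_mx0 addr0 mulmxA -map_mxM mulmxE.
  by rewrite -exprzDr ?CS_unit// subrr expr0z map_mx1 mul1mx.
have nl' : ~ lattice (position c (K + k) (place K 0 v) x) by rewrite pE.
have := level_bounds c (K + k) sx (den_gt0_nonlattice sx nl').
have := ge_floor t; have := floorD1_gt t.
have kb : 0 <= (k%:~R : R) <= 1 by case: k01 => ->; rewrite ?mulr0z ?mulr1z; lra.
rewrite !rmorphD /= KE => f1 f0 lb.
have [||c' [k' [v' [x' [s' p' l']]]]] := @reach 12 c (K + k) _ x t sx nl'.
- lra.
- by rewrite rmorphD /= KE; lra.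
by exists c', k', v', x'; split => //; rewrite p'.
Qed.

End Surjectivity.

(** * Faces with the same weights are glued *)

Definition relabel (f f' s : seq nat) : seq nat :=
  [seq nth 0%N f' (index i f) | i <- s].

(** Tests that [s] lies in the facet [f] and that the order-preserving gluing of [f] to [f'] carries
    coordinates on [s] to coordinates on the relabelled face. *)
Definition relabel_ok (f f' s : seq nat) : bool :=
  all (mem f) s &&
  all (fun i => let j := nth 0%N f (index i f') in
         if i \in f' then ((i \in relabel f f' s) == (j \in s)) &&
                          (index i (relabel f f' s) == index j s)
         else i \notin relabel f f' s) (iota 0 5).

Definition neighbours (a : bool * seq nat) : seq (bool * seq nat) :=
  [seq (e.2.1, relabel e.1.2 e.2.2 a.2) | e <- gluings &
     (e.1.1 == a.1) && relabel_ok e.1.2 e.2.2 a.2] ++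
  [seq (e.1.1, relabel e.2.2 e.1.2 a.2) | e <- gluings &
     (e.2.1 == a.1) && relabel_ok e.2.2 e.1.2 a.2].

(** Faces linked to [a] by chains of gluings. Any number of rounds is sound; ten suffice for the
    check in [same_heights_component]. *)
Definition component (a : bool * seq nat) : seq (bool * seq nat) :=
  iter 10 (fun L => undup (L ++ flatten [seq neighbours b | b <- L])) [:: a].

Definition all_faces : seq (seq nat) :=
  foldr (fun i L => [seq i :: s | s <- L] ++ L) [:: [::]] (iota 0 5).

(** Equality of edge heights up to a common constant, normalised on the first edge and written with
    sums to avoid truncated subtraction. *)
Definition same_heights (a b : bool * seq nat) : bool :=
  (size a.2 == size b.2) &&
  all (fun i => all (fun j => (i < j)%N ==>
    (height b.1 (nth 0 b.2 i) (nth 0 b.2 j) +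
       height a.1 (nth 0 a.2 0) (nth 0 a.2 1) ==
     height a.1 (nth 0 a.2 i) (nth 0 a.2 j) +
       height b.1 (nth 0 b.2 0) (nth 0 b.2 1))%N)
    (iota 0 (size a.2))) (iota 0 (size a.2)).

Definition oriented_faces : seq (bool * seq nat) :=
  [seq (true, s) | s <- all_faces] ++ [seq (false, s) | s <- all_faces].

(** A finite verification: edge heights up to a constant determine the gluing class of a face. *)
Lemma same_heights_component : all (fun a =>
  let C := component a in
  all (fun b => if same_heights a b then b \in C else true) oriented_faces)
  oriented_faces.
Proof. by vm_compute. Qed.

Lemma filter_faces (P : pred nat) : [seq i <- iota 0 5 | P i] \in all_faces.
Proof.
rewrite /=; case: (P 0%N); case: (P 1%N); case: (P 2%N); case: (P 3%N);
  by case: (P 4%N).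
Qed.

Section Classes.
Context (R : realType).
Implicit Types (x y : 'rV[R]_5) (k : int) (z v : 'cV[int]_3) (c : bool).

Definition nonvertex x := simplex x /\ 0 < den x.

Lemma ideal_nonvertex x : ideal_pentachoron x <-> nonvertex x.
Proof.
split=> [[x0 x1 nv]|[[x0 x1] d0]].
  have sx : simplex x by [].
  by split=> //; apply: den_gt0 => // i xi; apply: (nv i); rewrite xi.
split=> // i xi'; have xi : x = delta_mx 0 i.
  by apply/matrixP => a b; rewrite xi'.
move: d0; rewrite xi -(inord_val i) /den big_seq_cond big1 ?ltxx//.
move=> e /andP[/ordered_pairsP/andP[e1 e2] _].
rewrite !cf_delta//; last exact: ltn_trans e2.
by case: eqP => [<-|_]; rewrite ?mul0r// gtn_eqF ?mulr0.
Qed.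

Definition pentachoron_point c x (h : ideal_pentachoron x) : two_pentachora R :=
  existT (fun=> @ideal_pentachoron R : Type) c (SigSub (mem_set h)).

(** An option, so that classes of raw coordinate vectors can be compared and rewritten without
    carrying proofs of ideality. *)
Definition point_class c x : option (glued_pentachora R) :=
  match pselect (ideal_pentachoron x) with
  | left h => Some (\pi_(glued_pentachora R) (pentachoron_point c h))
  | right _ => None
  end.

Lemma simplex_tetraP f (t : 'rV[R]_4) : size f = 4%N -> uniq f ->
  all (fun i => i < 5)%N f ->
  simplex (tetra_point f t) <-> (forall i, 0 <= t 0 i) /\ \sum_i t 0 i = 1.
Proof.
move=> f4 uf f5; split=> [[t0 t1]|[]]; last exact: simplex_tetra.
split; last by rewrite -(sum_tetra f).
move=> i; have i4 : (i < size f)%N by rewrite f4.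
have := t0 (inord (nth 0%N f i)); rewrite -/(cf (tetra_point f t) (nth 0%N f i)).
rewrite tetra_pointE// ?mem_nth// ?index_uniq// ?inord_val//.
by move/allP: f5; apply; rewrite mem_nth.
Qed.

Lemma gluings_size e : e \in gluings ->
  [/\ size e.1.2 = 4%N, uniq e.1.2 & all (fun i => i < 5)%N e.1.2] /\
  [/\ size e.2.2 = 4%N, uniq e.2.2 & all (fun i => i < 5)%N e.2.2].
Proof. by rewrite !inE; do 4?case/orP; move=> /eqP ->. Qed.

Lemma glued_class e (t : 'rV[R]_4) : e \in gluings ->
  point_class e.1.1 (tetra_point e.1.2 t) = point_class e.2.1 (tetra_point e.2.2 t).
Proof.
move=> eg; have [[s1 u1 f1] [s2 u2 f2]] := gluings_size eg.
have [k' [v' w]] := weight_gluing t 0 0 eg.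
(* Equal weights give equal [den], so the two points are ideal together and their classes are both
   defined or both [None]. *)
have id12 : ideal_pentachoron (tetra_point e.1.2 t) <->
    ideal_pentachoron (tetra_point e.2.2 t).
  by rewrite !ideal_nonvertex /nonvertex !simplex_tetraP// (weight_den w).
rewrite /point_class; case: pselect => h1; case: pselect => h2 //; last 2 first.
- by exfalso; apply: h2; apply/id12.
- by exfalso; apply: h1; apply/id12.
congr Some; apply/gen_quotP/rst_step; exists e => //; exists t.
by split.
Qed.

Definition face_point (s : seq nat) (t : seq R) : 'rV[R]_5 :=
  \row_j (if (j : nat) \in s then nth 0 t (index (j : nat) s) else 0).

Lemma face_pointE s t i : (i < 5)%N ->
  cf (face_point s t) i = if i \in s then nth 0 t (index i s) else 0.
Proof. by move=> i5; rewrite /cf mxE inordK. Qed.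

Lemma relabel_tetra f f' s t : size f = 4%N -> uniq f ->
  all (fun i => i < 5)%N f -> size f' = 4%N -> uniq f' ->
  all (fun i => i < 5)%N f' -> relabel_ok f f' s ->
  face_point s t = tetra_point f (face f (face_point s t)) /\
  face_point (relabel f f' s) t = tetra_point f' (face f (face_point s t)).
Proof.
move=> f4 uf f5 f4' uf' f5' /andP[/allP sf /allP ok]; split.
  apply: face_tetra => // i i5 ni; rewrite face_pointE//.
  by case: ifPn => // /sf; rewrite /= (negPf ni).
apply: row5_ext => i i5; rewrite face_pointE// tetra_pointE//.
have := ok i; rewrite mem_iota => /(_ i5) /=.
case fi: (i \in f'); last by move=> /negPf ->.
move=> /andP[/eqP -> /eqP ->].
have ii : (index i f' < 4)%N by rewrite -f4' index_mem.
by rewrite mxE inordK// face_pointE//; move/allP: f5; apply; rewrite mem_nth// f4.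
Qed.

Lemma neighbours_class a b t : b \in neighbours a ->
  point_class a.1 (face_point a.2 t) = point_class b.1 (face_point b.2 t).
Proof.
rewrite mem_cat => /orP[] /mapP[e];
  rewrite mem_filter => /andP[/andP[/eqP <- ok] eg] ->;
  have [[s1 u1 f1] [s2 u2 f2]] := gluings_size eg.
- have [E E'] := relabel_tetra t s1 u1 f1 s2 u2 f2 ok.
  by rewrite E E'; exact: glued_class.
- have [E E'] := relabel_tetra t s2 u2 f2 s1 u1 f1 ok.
  by rewrite E E'; symmetry; exact: glued_class.
Qed.

Lemma component_class a b t : b \in component a ->
  point_class a.1 (face_point a.2 t) = point_class b.1 (face_point b.2 t).
Proof.
rewrite /component; elim: 10%N b => [|n IH] b; first by rewrite inE => /eqP ->.
rewrite iterS mem_undup mem_cat => /orP[|/flattenP[L /mapP[d dn ->]]]; first exact: IH.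
by move=> /(neighbours_class t) <-; exact: IH.
Qed.

Definition support x : seq nat := [seq i <- iota 0 5 | 0 < cf x i].

Lemma face_point_support x : simplex x ->
  x = face_point (support x) [seq cf x i | i <- support x].
Proof.
move=> sx; apply: row5_ext => i i5; rewrite face_pointE//.
case: ifPn => [si|]; first by rewrite (nth_map 0%N) ?index_mem// nth_index.
rewrite mem_filter mem_iota /= i5 andbT -leNgt => xi.
by apply/le_anti; rewrite xi simplex_cf.
Qed.

Lemma weight_vert c k v x i : (i < 5)%N -> weight c k v x (vert c k v i) = cf x i.
Proof.
move=> i5; rewrite /weight (bigD1 (inord i))//= inordK// eqxx mulr1 big1 ?addr0//.
move=> j ji; rewrite vert_eq//; case: eqP => [E|]; last by rewrite mulr0.
by case/negP: ji; apply/eqP/val_inj; rewrite /= inordK.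
Qed.

Lemma weight_gt0 c k v x z : simplex x ->
  (0 < weight c k v x z) = (z \in [seq vert c k v i | i <- support x]).
Proof.
move=> sx; apply/idP/mapP => [|[i]]; last first.
  by rewrite mem_filter mem_iota => /andP[xi /= i5] ->; rewrite weight_vert.
move=> w0; have [[i iz]|ni] := pselect (exists i : 'I_5, vert c k v i = z).
  exists (i : nat) => //; rewrite mem_filter mem_iota /= ltn_ord andbT.
  by rewrite -(weight_vert c k v)// iz.
move: w0; rewrite /weight big1 ?ltxx// => i _; case: eqP => [iz|]; last by rewrite mulr0.
by case: ni; exists i.
Qed.

(** Both lists enumerate the lattice points of positive weight in increasing order of [ell], so they
    agree as lists and not only as sets. *)
Lemma support_vert c k v x c' k' v' x' : simplex x -> simplex x' ->
  weight c k v x =1 weight c' k' v' x' ->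
  [seq vert c k v i | i <- support x] = [seq vert c' k' v' i | i <- support x'].
Proof.
move=> sx sx' E.
have srt c1 k1 v1 x1 : sorted (fun z z' => ell R z < ell R z')
    [seq vert c1 k1 v1 i | i <- support x1].
  rewrite sorted_map.
  have := sorted_filter ltn_trans (fun i => 0 < cf x1 i) (iota_ltn_sorted 0 5).
  apply: (@sub_in_sorted _ (gtn 5)); last first.
    by apply/allP => i; rewrite mem_filter mem_iota => /andP[].
  move=> i j _ /= j5 ij.
  rewrite !ell_place ltrD2r ltr_pM2l ?lam_exp_gt0//.
  by rewrite -subr_gt0 ell_vtx// exprn_gt0// lam_gt0.
apply: (irr_sorted_eq _ _ (srt _ _ _ _) (srt _ _ _ _)).
- by move=> z1 z2 z3; exact: lt_trans.
- by move=> z1; exact: ltxx.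
- by move=> z; rewrite -!weight_gt0// E.
Qed.

(** Equal weights give the same vertices and coordinates in the same order. Corresponding edges then
    have equal [eta], so their heights differ by the constant [k' - k] and the finite verification
    applies. *)
Lemma weight_class c k v x c' k' v' x' : nonvertex x -> nonvertex x' ->
  weight c k v x =1 weight c' k' v' x' -> point_class c x = point_class c' x'.
Proof.
move=> [sx _] [sx' _] E; have S := support_vert sx sx' E.
have T : [seq cf x i | i <- support x] = [seq cf x' i | i <- support x'].
  transitivity [seq weight c k v x z | z <- [seq vert c k v i | i <- support x]].
    rewrite -map_comp; apply/eq_in_map => i.
    by rewrite mem_filter mem_iota => /andP[_ i5]; rewrite /= weight_vert.
  rewrite S -map_comp; apply/eq_in_map => i.
  by rewrite mem_filter mem_iota => /andP[_ i5]; rewrite /= E weight_vert.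
rewrite (face_point_support sx) (face_point_support sx') -T.
apply: (@component_class (c, support x) (c', support x')).
have sz : size (support x) = size (support x').
  by have := congr1 size S; rewrite !size_map.
have faces a y : (a, support y) \in oriented_faces.
  rewrite mem_cat; apply/orP; case: a; [left|right];
    by apply/mapP; exists (support y) => //; exact: filter_faces.
have /allP/(_ _ (faces c x))/allP/(_ _ (faces c' x')) := same_heights_component.
case: ifPn => // /negP []; rewrite /same_heights /= sz eqxx /=.
have lt5 y i : (i < size (support y))%N -> (nth 0 (support y) i < 5)%N.
  by move=> /(mem_nth 0%N); rewrite mem_filter mem_iota => /andP[].
have srt y i j : (i < j)%N -> (j < size (support y))%N ->
    (nth 0 (support y) i < nth 0 (support y) j)%N.
  move=> ij js.
  have := sorted_filter ltn_trans (fun i => 0 < cf y i) (iota_ltn_sorted 0 5).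
  by move/(sorted_ltn_nth ltn_trans 0%N); apply => //; rewrite inE//; exact: ltn_trans js.
have H i j : (i < j)%N -> (j < size (support x'))%N ->
    k%:~R + (height c (nth 0 (support x) i) (nth 0 (support x) j))%:R =
    k'%:~R + (height c' (nth 0 (support x') i) (nth 0 (support x') j))%:R :> R.
  move=> ij js; have js' : (j < size (support x))%N by rewrite sz.
  rewrite -(eta_vert R c k v) ?srt ?lt5// -(eta_vert R c' k' v') ?srt ?lt5//.
  have nS l : (l < size (support x'))%N -> vert c k v (nth 0 (support x) l) =
      vert c' k' v' (nth 0 (support x') l).
    move=> l5; have := congr1 (fun s => nth 0 s l) S.
    by rewrite !(nth_map 0%N) ?sz.
  by rewrite !nS//; exact: ltn_trans js.
apply/allP => i; rewrite mem_iota => /= iS; apply/allP => j; rewrite mem_iota => /= js.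
apply/implyP => ij.
have h1 := H i j ij js.
have h0 := H 0%N 1%N isT (leq_ltn_trans (leq_ltn_trans (leq0n i) ij) js).
by rewrite -(eqr_nat R) !natrD; apply/eqP; lra.
Qed.

End Classes.

(** * The map to the mapping torus *)

Section Bundle.
Context (R : realType).
Implicit Types (k : int) (z : 'cV[int]_3) (c : bool) (p : 'cV[R]_3) (t : R).

Notation mono := (monodromy R CS_matrix_unit).
Notation CS := (cappell_shaneson R CS_matrix_unit).

Lemma origin_lattice p : \pi_(torus3 R) p = torus3_origin R <-> lattice p.
Proof.
split=> [/esym/torus3P[z ->]|[z ->]]; first by exists z; rewrite addr0.
by symmetry; apply/torus3P; exists z; rewrite addr0.
Qed.

Lemma punctured_pi p : ~ lattice p -> \pi_(torus3 R) p \in punctured_torus3 R.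
Proof. by move=> nl; apply/mem_set => /origin_lattice. Qed.

Definition punctured_point p (nl : ~ lattice p) : punctured_torus3 R :=
  SigSub (punctured_pi nl).

Lemma punctured_repr (P : punctured_torus3 R) : ~ lattice (repr (set_val P)).
Proof.
move=> /origin_lattice; rewrite reprK => E; exact: (set_valP P).
Qed.

Lemma val_homeo_iter k (P : punctured_torus3 R) :
  set_val (homeo_iter mono k P) = torus3_map (CS_matrix ^ k) (set_val P).
Proof.
have iterE (B : 'M[int]_3) (uB : B \in unitmx) n :
    set_val (iter n (@punctured_torus3_map R B uB) P) =
    torus3_map (B ^+ n) (set_val P).
  elim: n => [|n IH] /=; first by rewrite expr0 torus3_map1.
  by rewrite exprS -mulmxE -torus3_mapM -IH.
case: k => n; first exact: iterE.
rewrite (_ : CS_matrix ^ Negz n = (invmx CS_matrix) ^+ n.+1); first exact: iterE.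
by rewrite NegzE -exprnN -exprVn.
Qed.

(** The generating relation is already an equivalence, because the powers of the monodromy form a
    group. *)
Lemma CS_eq (P P' : punctured_torus3 R) t t' :
  \pi_CS (P, t) = \pi_CS (P', t') <->
  exists k, set_val P' = torus3_map (CS_matrix ^ k) (set_val P) /\ t' = k%:~R + t.
Proof.
split=> [/gen_quotP H|[k [E ->]]]; last first.
  apply/gen_quotP/rst_step; exists k; congr (_, _); apply: val_inj => /=.
  by rewrite -[RHS]/(set_val _) val_homeo_iter.
suff {H} S u v : clos_refl_sym_trans (punctured_torus3 R * R) (fun u v =>
    exists n, v = (homeo_iter mono n u.1, n%:~R + u.2)) u v ->
    exists k, set_val v.1 = torus3_map (CS_matrix ^ k) (set_val u.1) /\
      v.2 = k%:~R + u.2 by exact: S H.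
elim=> {u v P t P' t'} [u v [k ->]|u|u v _ [k [E E']]|
  u v w _ [k [E1 E1']] _ [l [E2 E2']]].
- by exists k => /=; rewrite val_homeo_iter.
- by exists 0; rewrite expr0z torus3_map1 add0r.
- exists (- k); rewrite E E' torus3_mapM mulmxE -exprzDr ?CS_unit// addNr expr0z.
  by rewrite torus3_map1 rmorphN addKr.
- exists (l + k); rewrite E2 E1 E2' E1' torus3_mapM mulmxE -exprzDr ?CS_unit//.
  by rewrite rmorphD addrA.
Qed.

Lemma CS_point_eq p p' t t' (h : ~ lattice p) (h' : ~ lattice p') :
  \pi_CS (punctured_point h, t) = \pi_CS (punctured_point h', t') <->
  exists k z, p' = map_mx intr (CS_matrix ^ k) *m p + map_mx intr z /\
              t' = k%:~R + t.
Proof.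
rewrite CS_eq; split=> [[k [E ->]]|[k [z [E ->]]]]; exists k.
  move: E; rewrite /= torus3_mapE => /esym/torus3P[z ->].
  by exists z; rewrite addrC.
split=> //=; rewrite torus3_mapE; symmetry; apply/torus3P; exists z.
by rewrite E addrC.
Qed.

Lemma ideal_nonlattice c (x : 'rV[R]_5) :
  ideal_pentachoron x -> ~ lattice (position c 0 0 x).
Proof.
move=> ix; have [sx d0] := (ideal_nonvertex x).1 ix.
move=> /(lattice_position sx)[i xi]; case: ix => _ _ /(_ i); apply.
by rewrite xi.
Qed.

Definition bundle_fun c (x : @ideal_pentachoron R) : CS :=
  \pi_CS (punctured_point (@ideal_nonlattice c (set_val x) (set_valP x)),
          level c 0 (set_val x)).

Definition bundle_map : two_pentachora R -> CS := unstable.sigT_fun bundle_fun.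

Lemma existT_class (u : two_pentachora R) :
  point_class (projT1 u) (set_val (projT2 u)) = Some (\pi_(glued_pentachora R) u).
Proof.
rewrite /point_class; case: pselect => [h|]; last first.
  by case; exact: (set_valP (projT2 u)).
congr (Some (\pi _)); case: u h => c x h; congr existT; exact: val_inj.
Qed.

Lemma positionS c k z (x : 'rV[R]_5) : simplex x ->
  map_mx intr (CS_matrix ^ k) *m position c 0 0 x + map_mx intr z =
  position c k z x :> 'cV[R]_3.
Proof. by move=> [_ x1]; rewrite (positionE c k) x1 scale1r. Qed.

Lemma levelS c k (x : 'rV[R]_5) : level c k x = k%:~R + level c 0 x.
Proof. by rewrite /level add0r. Qed.

(** Injectivity comes from [level_inj] followed by [weight_class]; well-definedness from
    [weight_gluing] on each generating identification. *)
Lemma bundle_map_eq u v :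
  bundle_map u = bundle_map v <-> \pi_(glued_pentachora R) u = \pi_(glued_pentachora R) v.
Proof.
have nv (w : two_pentachora R) : nonvertex (set_val (projT2 w)).
  by apply/ideal_nonvertex; exact: (set_valP (projT2 w)).
split=> [|/gen_quotP].
  have [su _] := nv u; have [sv _] := nv v.
  move: (nv u) (nv v) (existT_class u) (existT_class v) su sv.
  case: u => c x; case: v => c' x' /= nx nx' cx cx' su sv.
  rewrite /bundle_map /unstable.sigT_fun /= => /CS_point_eq[k [z [E E']]].
  apply: Some_inj; rewrite -cx -cx'.
  apply: (@weight_class _ c k z _ c' 0 0) => //.
  apply: level_inj => //.
  - rewrite -(positionS c k z su) -E; exact/ideal_nonlattice/set_valP.
  - by rewrite -(positionS c k z su).
  - by rewrite levelS -E'.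
elim=> {u v} [u v g|//|u v _ ->//|u v w _ -> _ ->//].
have := nv u; have := nv v; case: g => e eg [t []].
case: u => c x; case: v => c' x' /= -> xe -> xe' [sv dv] [su du].
rewrite /bundle_map /unstable.sigT_fun /=.
have [k [z w]] := weight_gluing t 0 0 eg.
symmetry; apply/CS_point_eq; exists k, z.
rewrite (positionS _ _ _ sv) -(levelS e.2.1); split.
  by rewrite xe xe' (weight_position w).
rewrite xe xe'; apply: (@weight_level _ _ _ 0); last exact: w.
by rewrite -xe gt_eqF.
Qed.

Lemma bundle_map_onto (y : CS) : exists u, bundle_map u = y.
Proof.
rewrite -[y]reprK; case: (repr y) => P t {y}.
have [c [k [z [x [sx E lE]]]]] := level_onto t (@punctured_repr P).
have nl : ~ lattice (position c k z x) by rewrite E; exact: punctured_repr.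
have ix : ideal_pentachoron x.
  by apply/ideal_nonvertex; split=> //; exact: den_gt0_nonlattice nl.
exists (pentachoron_point c ix); rewrite /bundle_map /unstable.sigT_fun /=.
have -> : P = punctured_point (@punctured_repr P).
  by apply: val_inj; rewrite /= reprK.
apply/CS_point_eq; exists k, z; rewrite positionS//.
by split; [rewrite E|rewrite -levelS lE].
Qed.

End Bundle.

(** * Continuity of the map and of its inverse *)

Section Topology.
Context (R : realType).
Implicit Types (k : int) (z : 'cV[int]_3) (c : bool) (p : 'cV[R]_3) (t : R).

Notation CS := (cappell_shaneson R CS_matrix_unit).

Lemma cvg_matrix (T : topologicalType) m n (f : T -> 'M[R]_(m, n)) (a : T) :
  (forall i j, {for a, continuous (fun y => f y i j)}) -> {for a, continuous f}.
Proof.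
move=> cf U [P Pfa PU].
have : \forall y \near a, forall ij : 'I_m * 'I_n, P ij.1 ij.2 (f y ij.1 ij.2).
  apply: (@filter_forall _ _ (fun ij y => P ij.1 ij.2 (f y ij.1 ij.2)) _
    (nbhs_filter a)) => -[i j] /=.
  exact: cf (Pfa i j).
by apply: filterS => y Py; apply: PU => i j; exact: (Py (i, j)).
Qed.

Lemma continuous_cf i : continuous (fun x : 'rV[R]_5 => cf x i).
Proof. exact: coord_continuous. Qed.

Lemma continuous_sum_seq (T : topologicalType) (I : eqType) (s : seq I)
    (F : I -> T -> R) : (forall i, continuous (F i)) ->
  continuous (fun x => \sum_(i <- s) F i x).
Proof.
move=> cF; apply: (@continuous_big R _ +%R 0 xpredT _ T s F) => [|i _]; last exact: cF.
exact: add_continuous.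
Qed.

Lemma continuous_mul (T : topologicalType) (f g : T -> R) (a : T) :
  {for a, continuous f} -> {for a, continuous g} ->
  {for a, continuous (fun y => f y * g y)}.
Proof. by move=> cf cg; apply: (@cvgM _ _ _ (nbhs_filter a) f g). Qed.

Lemma continuous_add (T : topologicalType) (f g : T -> R) (a : T) :
  {for a, continuous f} -> {for a, continuous g} ->
  {for a, continuous (fun y => f y + g y)}.
Proof. by move=> cf cg; apply: (@cvgD _ _ _ _ (nbhs_filter a) f g). Qed.

Lemma continuous_const (T : topologicalType) (b : R) (a : T) :
  {for a, continuous (fun=> b)}.
Proof. exact: (@cvg_cst _ _ _ _ (nbhs_filter a)). Qed.

Lemma continuous_num c : continuous (@num R c).
Proof.
apply: (@continuous_sum_seq _ _ ordered_pairs (fun e (x : 'rV[R]_5) =>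
  (height c e.1 e.2)%:R * cf x e.1 * cf x e.2)) => e x.
apply: (@continuous_mul _ (fun x => (height c e.1 e.2)%:R * cf x e.1)
  (fun x => cf x e.2)); last exact: continuous_cf.
apply: (@continuous_mul _ (fun=> (height c e.1 e.2)%:R) (fun x => cf x e.1)).
  exact: continuous_const.
exact: continuous_cf.
Qed.

Lemma continuous_den : continuous (@den R).
Proof.
apply: (@continuous_sum_seq _ _ ordered_pairs (fun e (x : 'rV[R]_5) =>
  cf x e.1 * cf x e.2)) => e x.
by apply: (@continuous_mul _ (fun x => cf x e.1) (fun x => cf x e.2));
  exact: continuous_cf.
Qed.

Lemma continuous_level c k (x : 'rV[R]_5) : den x != 0 ->
  {for x, continuous (level c k)}.
Proof.
move=> d0.
apply: (@continuous_add _ (fun=> k%:~R) (fun x => num c x / den x)).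
  exact: continuous_const.
apply: (@continuous_mul _ (num c) (fun x => (den x)^-1)).
  exact: continuous_num.
by apply: (@cvgV _ _ _ (nbhs_filter x) (@den R)) => //; exact: continuous_den.
Qed.

Lemma continuous_position c k z : continuous (@position R c k z).
Proof.
move=> x; apply: cvg_matrix => i j.
have -> : (fun y => position c k z y i j) =
    (fun y : 'rV[R]_5 => \sum_(l < 5) y 0 l * (vert c k z l i j)%:~R).
  by apply/funext => y; rewrite summxE; apply: eq_bigr => l _; rewrite !mxE.
apply: (@continuous_sum_seq _ _ (index_enum 'I_5) (fun l (y : 'rV[R]_5) =>
  y 0 l * (vert c k z l i j)%:~R)) => l {}x.
apply: (@continuous_mul _ (fun y : 'rV[R]_5 => y 0 l) (fun=> (vert c k z l i j)%:~R)).
  exact: coord_continuous.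
exact: continuous_const.
Qed.

Lemma continuous_bundle_fun c : continuous (@bundle_fun R c).
Proof.
pose G (x : @ideal_pentachoron R) : punctured_torus3 R * R :=
  (punctured_point (@ideal_nonlattice R c (set_val x) (set_valP x)),
   level c 0 (set_val x)).
suff cG : continuous G.
  by move=> x; apply: (@continuous_comp _ _ _ G \pi_CS); [exact: cG|exact: pi_continuous].
have c1 : continuous (fun x => (G x).1).
  apply: continuous_comp_initial => x.
  apply: (@continuous_comp _ _ _ (position c 0 0 \o set_val) \pi_(torus3 R)).
    apply: continuous_comp; first exact: initial_continuous.
    exact: continuous_position.
  exact: pi_continuous.
have c2 : continuous (fun x => (G x).2).
  move=> x.
  apply: (@continuous_comp _ _ _ set_val (level c 0)); first exact: initial_continuous.
  apply: continuous_level; rewrite gt_eqF//.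
  by have [] := (ideal_nonvertex (set_val x)).1 (set_valP x).
move=> x; exact: (cvg_pair (c1 x) (c2 x)).
Qed.

Lemma continuous_bundle_map : continuous (@bundle_map R).
Proof. exact/sigT_continuous/continuous_bundle_fun. Qed.

Lemma near_noninteger (r : R) : (forall m : int, r <> m%:~R) ->
  \forall s \near r, forall m : int, s <> m%:~R.
Proof.
move=> nr.
have lo : (Num.floor r)%:~R < r.
  by rewrite lt_neqAle ge_floor andbT; apply/eqP => /esym; exact: nr.
have hi : r < (Num.floor r + 1)%:~R := floorD1_gt r.
near=> s => m sm.
have : (Num.floor r)%:~R < s by near: s; exact: lt_nbhsr.
have : s < (Num.floor r + 1)%:~R by near: s; exact: lt_nbhsl.
by rewrite sm !ltr_int; lia.
Unshelve. all: by end_near. Qed.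

(** The saturation of an open set is a union of its integer translates. *)
Lemma torus3_pi_open (O : set 'cV[R]_3) : open O ->
  open (\pi_(torus3 R) @` O).
Proof.
move=> oO; rewrite /open /= /quotient_open.
have -> : \pi_(torus3 R) @^-1` (\pi_(torus3 R) @` O) =
    \bigcup_(z in [set: 'cV[int]_3]) ((fun y => map_mx intr z + y) @^-1` O).
  apply/seteqP; split=> y /=.
    by move=> [x Ox /esym/torus3P[z E]]; exists z => //=; rewrite -E.
  by move=> [z _ Oz]; exists (map_mx intr z + y) => //; symmetry; apply/torus3P; exists z.
apply: bigcup_open => z _; apply: open_comp => // y _.
apply: cvg_matrix => i j.
have -> : (fun w : 'cV[R]_3 => (map_mx intr z + w) i j) =
    (fun w : 'cV[R]_3 => (z i j)%:~R + w i j).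
  by apply/funext => w; rewrite !mxE.
apply: (@continuous_add _ (fun=> (z i j)%:~R) (fun w : 'cV[R]_3 => w i j)).
  exact: continuous_const.
exact: coord_continuous.
Qed.

Lemma near_pentachoron_point (C : set (two_pentachora R)) c (x : 'rV[R]_5)
    (h : ideal_pentachoron x) : closed C -> ~ C (pentachoron_point c h) ->
  \forall y \near x, forall h' : ideal_pentachoron y, ~ C (pentachoron_point c h').
Proof.
move=> clC nC.
have oC : open (~` C) by exact: closed_openC.
have [V oV VE] := (sigT_openP (~` C)).1 oC c.
have Vx : V x.
  have : (set_val @^-1` V) (SigSub (mem_set h)) by rewrite VE.
  by [].
have : nbhs x V by exact: open_nbhs_nbhs.
apply: filterS => y Vy h'.
by have : (set_val @^-1` V) (SigSub (mem_set h')) by []; rewrite VE.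
Qed.

Let W : topologicalType := ('rV[R]_5 * ('cV[R]_3 * R))%type.

(** A translation placing [w.1] over [w.2.1] exists exactly when all offsets are integers (for [w.1]
    in the simplex), which treats the infinitely many translations at once. *)
Definition offset c k (i : 'I_3) (w : W) : R :=
  w.2.1 i 0 - position c k 0 w.1 i 0.

Lemma continuous_offset c k i : continuous (offset c k i).
Proof.
move=> w; apply: (@continuous_add W (fun w : W => w.2.1 i 0)
  (fun w : W => - position c k 0 w.1 i 0)).
  apply: (@continuous_comp _ _ _ (fun w : W => w.2.1)
    (fun p : 'cV[R]_3 => p i 0)); last exact: coord_continuous.
  apply: (@continuous_comp _ _ _ snd fst); first exact: cvg_snd.
  exact: cvg_fst.
apply: (@cvgN _ _ _ _ (nbhs_filter w) (fun w : W => position c k 0 w.1 i 0)).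
apply: (@continuous_comp _ _ _ (fun w : W => position c k 0 w.1)
    (fun p : 'cV[R]_3 => p i 0)); last exact: coord_continuous.
apply: (@continuous_comp _ _ _ fst (position c k 0)); first exact: cvg_fst.
exact: continuous_position.
Qed.

Lemma offset_integer c k i z (x : 'rV[R]_5) (u : 'cV[R]_3 * R) : simplex x ->
  u.1 = position c k z x -> offset c k i (x, u) = (z i 0)%:~R.
Proof.
move=> sx E; rewrite /offset /= E -(positionS c k z sx) -(positionS c k 0 sx).
move: (_ *m position c 0 0 x) => a.
by rewrite map_mx0 addr0 !mxE addrAC subrr add0r.
Qed.

(** Compactness of the cube reduces this to neighbourhoods of single points [x]. One of four open
    conditions applies: the coordinates do not sum to 1, some offset is not an integer, [x] is not
    in [C], or its level is not [t]. *)
Lemma near_piece (C : set (two_pentachora R)) c k p t : closed C -> ~ lattice p ->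
  (forall x (h : ideal_pentachoron x) z, C (pentachoron_point c h) ->
    p = position c k z x -> t <> level c k x) ->
  \forall u \near (p, t), forall x (h : ideal_pentachoron x) z,
    C (pentachoron_point c h) -> u.1 = position c k z x -> u.2 <> level c k x.
Proof.
move=> clC nl sep.
pose K : set 'rV[R]_5 := [set x | forall i, `[0, 1]%classic (x ord0 i)].
have cK : compact K.
  exact: (@rV_compact R 5 (fun=> `[0, 1]%classic) (fun=> @segment_compact R 0 1)).
pose Q (u : 'cV[R]_3 * R) x := forall (h : ideal_pentachoron x) z,
  C (pentachoron_point c h) -> u.1 = position c k z x -> u.2 <> level c k x.
have : \forall u \near (p, t), K `<=` Q u.
  have nc := (compact_near_coveringP K).1 cK.
  apply: (nc _ (nbhs (p, t)) Q (nbhs_filter _)) => x Kx.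
  have ideal_simplex (y : 'rV[R]_5) : ideal_pentachoron y -> simplex y.
    by case/ideal_nonvertex.
  have [x1|x1] := eqVneq (\sum_i x 0 i) 1; last first.
    have csum : continuous (fun y : 'rV[R]_5 => \sum_i y 0 i - 1).
      move=> y; apply: (@continuous_add _ (fun y : 'rV[R]_5 => \sum_i y 0 i) (fun=> -1)).
        apply: (@continuous_sum_seq _ _ (index_enum 'I_5)
          (fun l (y : 'rV[R]_5) => y 0 l)).
        by move=> l; exact: coord_continuous.
      exact: continuous_const.
    have near1 : nbhs x [set y : 'rV[R]_5 | \sum_i y 0 i - 1 != 0].
      apply: (csum x [set s | s != 0]); apply: open_nbhs_nbhs.
      by split; [exact: open_neq|rewrite /= subr_eq0].
    exists ([set y : 'rV[R]_5 | \sum_i y 0 i - 1 != 0], setT).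
      by split=> //; exact: filterT.
    move=> [y u] /= [y1 _] h z _ _; have [_ E] := ideal_simplex _ h.
    by move: y1; rewrite E subrr eqxx.
  have sx : simplex x by split=> // i; have := Kx i; rewrite /= in_itv /= => /andP[].
  have [[i ni]|allint] := pselect
    (exists i, forall m : int, offset c k i (x, (p, t)) <> m%:~R).
    have H : nbhs (x, (p, t)) [set w : W | forall m : int, offset c k i w <> m%:~R].
      exact: (@continuous_offset c k i (x, (p, t))) (near_noninteger ni).
    change (nbhs ((x, (p, t)) : W) [set w : W | Q w.2 w.1]).
    apply: filterS H => -[y u] /= nu h z _ uE.
    by case: (nu (z i 0)); apply: offset_integer => //; exact: ideal_simplex.
  have [z pz] : exists z, p = position c k z x.
    have int' i : exists m : int, offset c k i (x, (p, t)) = m%:~R.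
      apply: contrapT => ni; apply: allint; exists i => m E; apply: ni; by exists m.
    have [f fE] := choice int'.
    exists (\col_i f i); rewrite -(positionS c k _ sx).
    have := positionS c k 0 sx; rewrite map_mx0 addr0 => ->.
    apply/matrixP => i j; rewrite ord1.
    have := fE i; rewrite /offset /=; move: (position c k 0 x) => a ai.
    by rewrite [RHS]mxE [X in _ + X]mxE mxE -ai subrKC.
  (* The deleted vertices cannot occur here: their positions are lattice points and [p] is not. *)
  have ix : ideal_pentachoron x.
    apply/ideal_nonvertex; split=> //; apply: (@den_gt0_nonlattice _ c k z) => //.
    by rewrite -pz.
  have [_ d0] := (ideal_nonvertex x).1 ix.
  have [Cx|nCx] := pselect (C (pentachoron_point c ix)); last first.
    exists ([set y | forall h' : ideal_pentachoron y,
      ~ C (pentachoron_point c h')], setT).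
      by split; [exact: near_pentachoron_point|exact: filterT].
    by move=> [y u] /= [ny _] h z' /ny.
  have ne : t - level c k x != 0.
    by rewrite subr_eq0; apply/eqP; apply: sep Cx pz.
  have cl : {for (x, (p, t)), continuous (fun w : W =>
      w.2.2 - level c k w.1)}.
    apply: (@continuous_add W (fun w : W => w.2.2)
      (fun w : W => - level c k w.1)).
      apply: (@continuous_comp _ _ _ snd snd); first exact: cvg_snd.
      exact: cvg_snd.
    apply: (@cvgN _ _ _ _ (nbhs_filter (x, (p, t)))
      (fun w : W => level c k w.1)).
    apply: (@continuous_comp _ _ _ fst (level c k)); first exact: cvg_fst.
    by apply: continuous_level; rewrite gt_eqF.
  have H : nbhs (x, (p, t)) [set w : W | w.2.2 - level c k w.1 != 0].
    apply: (cl [set s | s != 0]); apply: open_nbhs_nbhs.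
    by split; [exact: open_neq|].
  change (nbhs ((x, (p, t)) : W) [set w : W | Q w.2 w.1]).
  apply: filterS H => -[y u] /= nu h z' _ _ uE.
  by move: nu; rewrite uE subrr eqxx.
apply: filterS => u KQ x h; apply: KQ => i /=.
have [[x0 x1] _] := (ideal_nonvertex x).1 h.
rewrite in_itv /= x0 /= -x1 (bigD1 i)//= lerDl sumr_ge0//.
Qed.

Lemma near_pieces (C : set (two_pentachora R)) p t : closed C -> ~ lattice p ->
  (forall c k x (h : ideal_pentachoron x) z, C (pentachoron_point c h) ->
    p = position c k z x -> t <> level c k x) ->
  nbhs (p, t) [set u : 'cV[R]_3 * R |
    forall c k x (h : ideal_pentachoron x) z,
    C (pentachoron_point c h) -> u.1 = position c k z x -> u.2 <> level c k x].
Proof.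
move=> clC nl sep; pose n := Num.floor t.
(* For times between [n - 1] and [n + 2], [level_bounds] leaves only [n - 9 <= k < n + 2], which the
   twelve values cover. *)
have H1 : nbhs (p, t) [set u : 'cV[R]_3 * R | forall b : bool * 'I_12,
    forall x (h : ideal_pentachoron x) z, C (pentachoron_point b.1 h) ->
    u.1 = position b.1 (n - 9 + (b.2 : nat)%:Z) z x ->
    u.2 <> level b.1 (n - 9 + (b.2 : nat)%:Z) x].
  apply: (@filter_forall _ _ (fun (b : bool * 'I_12) (u : 'cV[R]_3 * R) =>
    forall x (h : ideal_pentachoron x) z, C (pentachoron_point b.1 h) ->
    u.1 = position b.1 (n - 9 + (b.2 : nat)%:Z) z x ->
    u.2 <> level b.1 (n - 9 + (b.2 : nat)%:Z) x) _ (nbhs_filter (p, t))) => b.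
  by apply: near_piece => // x h z; exact: sep.
have [f0 f1] : n%:~R <= t /\ t < n%:~R + 1.
  by split; [exact: ge_floor|rewrite -(rmorphD _ n 1); exact: floorD1_gt].
have H2 : nbhs (p, t) [set u : 'cV[R]_3 * R | n%:~R - 1 < u.2].
  apply: (@cvg_snd _ _ (nbhs p) (nbhs t) _ [set s | n%:~R - 1 < s]).
  by apply: lt_nbhsr; lra.
have H3 : nbhs (p, t) [set u : 'cV[R]_3 * R | u.2 < n%:~R + 2].
  apply: (@cvg_snd _ _ (nbhs p) (nbhs t) _ [set s | s < n%:~R + 2]).
  by apply: lt_nbhsl; lra.
apply: filterS (filterI H1 (filterI H2 H3)) => -[q s] /= [h1 [h2 h3]] c k x h z Cx qE sE.
have [sx d0] := (ideal_nonvertex x).1 h.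
have /andP[l0 l1] := level_bounds c k sx d0.
have k0 : n - 9 <= k.
  by rewrite -(ler_int R) rmorphB /=; lra.
have k1 : k < n + 2.
  by rewrite -(ltr_int R) rmorphD /=; lra.
have [d kE] : exists d : nat, k = n - 9 + d%:Z.
  by exists (absz (k - (n - 9))%R); lia.
have d12 : (d < 12)%N by lia.
by apply: (h1 (c, Ordinal d12) x h z); rewrite /= -?kE.
Qed.

Definition bundle_inv (y : CS) : glued_pentachora R :=
  \pi_(glued_pentachora R) (sval (cid (bundle_map_onto y))).

Lemma bundle_mapK (u : two_pentachora R) :
  bundle_inv (bundle_map u) = \pi_(glued_pentachora R) u.
Proof. by rewrite /bundle_inv; case: cid => v /= /bundle_map_eq. Qed.

(** The map is closed: [near_pieces] gives a neighbourhood upstairs that avoids the image of the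
    complement of a saturated open set, and openness of the torus projection brings it down. *)
Lemma continuous_bundle_inv : continuous bundle_inv.
Proof.
apply/quotient_continuous => -[P t] N /=; rewrite nbhsE => -[V [oV VP] VN].
pose C : set (two_pentachora R) := ~` (\pi_(glued_pentachora R) @^-1` V).
have clC : closed C by apply: open_closedC; exact: oV.
have nl := @punctured_repr R P; set p := repr (set_val P) in nl.
have PE : P = punctured_point nl by apply: val_inj; rewrite /= reprK.
have [|[B1 B2] /= [pB1 tB2] sub] := near_pieces (t := t) clC nl.
  move=> c k x h z Cx pE tE; apply: Cx => /=; rewrite -bundle_mapK.
  suff -> : bundle_map (pentachoron_point c h) = \pi_CS (P, t) by [].
  have [sx _] := (ideal_nonvertex x).1 h.
  rewrite PE /bundle_map /unstable.sigT_fun /=; apply/CS_point_eq.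
  by exists k, z; rewrite positionS// -levelS.
have nP : nbhs P [set P' : punctured_torus3 R |
    (\pi_(torus3 R) @` interior B1) (set_val P')].
  apply: (@initial_continuous _ _ set_val P).
  apply: open_nbhs_nbhs; split; first exact/torus3_pi_open/open_interior.
  by exists p; [exact: pB1|rewrite /p reprK].
exists ([set P' : punctured_torus3 R |
  (\pi_(torus3 R) @` interior B1) (set_val P')], B2) => //.
move=> [P' t'] /= [[p' p'B1 p'E] t'B2]; apply: VN.
apply: contrapT => nV; pose u := sval (cid (bundle_map_onto (\pi_CS (P', t')))).
have uE : bundle_map u = \pi_CS (P', t') :=
  svalP (cid (bundle_map_onto (\pi_CS (P', t')))).
have Cu : C u by [].
have nl' : ~ lattice p'.
  by move/origin_lattice; rewrite p'E; exact: (set_valP P').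
have P'E : P' = punctured_point nl' by apply: val_inj; rewrite /= p'E.
move: uE Cu; rewrite P'E; case: u => c x /= uE Cu.
have ix : ideal_pentachoron (set_val x) := set_valP x.
have [sx _] := (ideal_nonvertex (set_val x)).1 ix.
have [k [z [p'x t'x]]] := (CS_point_eq _ _ _ _).1 uE.
have := sub (p', t') (conj (interior_subset p'B1) t'B2) c k (set_val x) ix z.
apply.
- suff -> : pentachoron_point c ix = existT _ c x by [].
  by congr existT; exact: val_inj.
- by rewrite p'x positionS.
- by rewrite /= t'x [RHS]levelS.
Qed.

Definition glued_homeo : homeo (glued_pentachora R) CS.
Proof.
pose f (m : glued_pentachora R) : CS := bundle_map (repr m).
have fpi u : f (\pi_(glued_pentachora R) u) = bundle_map u.
  by apply/bundle_map_eq; rewrite reprK.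
apply: (@Homeo _ _ f bundle_inv).
- by move=> m; rewrite bundle_mapK reprK.
- move=> y; have [u <-] := bundle_map_onto y.
  by rewrite bundle_mapK fpi.
- apply/quotient_continuous.
  rewrite (_ : f \o _ = @bundle_map R); last by apply/funext => u; exact: fpi.
  exact: continuous_bundle_map.
- exact: continuous_bundle_inv.
Defined.

End Topology.

Theorem corollary2p7 (R : realType) :
  homeomorphic (glued_pentachora R) (cappell_shaneson R CS_matrix_unit).
Proof. by constructor; exact: glued_homeo. Qed.
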